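(* Let $H:\mathfrak C[\mathbb R^d]\times\mathfrak C[\mathbb R^d]\to\mathbb R$ be given by $$H([x_1,r_1],[x_2,r_2])=r_1+r_2-2\sqrt{r_1r_2}\,e^{-|x_1-x_2|^2/2},\qquad x_i\in\mathbb R^d,\ r_i\ge0.$$ If $\mu_1,\mu_2\in\mathcal M_+(\mathbb R^d)$ with $\mu_i(\mathbb R^d)>0$ for $i=1,2$ and $\mu_1\ll\mathcal L^d$ (Lebesgue measure), then there exists a transport-growth map, i.e. a Borel map $(T,g):\mathbb R^d\to\mathbb R^d\times[0,+\infty)$ with $g\in L^1(\mathbb R^d,\mu_1)$, such that $$\mu_2=T_\sharp(g\mu_1),\qquad \int_{\mathbb R^d}H([x,1],[T(x),g(x)])\,d\mu_1(x)=\mathcal U_H(\mu_1,\mu_2).$$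
   Context: $\mathcal M_+(\mathbb R^d)$ is the set of finite nonnegative Borel measures on $\mathbb R^d$. $\mathfrak C[\mathbb R^d]=(\mathbb R^d\times[0,+\infty))/\sim$, where $(x,r)\sim(y,s)$ iff ($x=y$ and $r=s\neq0$) or $r=s=0$; $[x,r]$ is the class of $(x,r)$ and $\mathfrak o=[x,0]$ the vertex. A neighbourhood base at $[x,r]$ with $r>0$ is given by the images of the neighbourhoods of $(x,r)$; a neighbourhood base at $\mathfrak o$ is given by the sets $\{[x,r]:0\le r<\varepsilon\}$, $\varepsilon>0$. The product of cones has the product topology. $\mathcal U_H(\mu_1,\mu_2):=\inf\{\int H\,d\alpha:\alpha\in\mathfrak H^1(\mu_1,\mu_2)\}$, where $\mathfrak H^1(\mu_1,\mu_2)$ is the set of nonnegative finite Borel measures $\alpha$ on $\mathfrak C[\mathbb R^d]\times\mathfrak C[\mathbb R^d]$ with $\int(r_1+r_2)\,d\alpha<+\infty$ and $\mu_i(A)=\int_{\{r_i>0,\ x_i\in A\}}r_i\,d\alpha([x_1,r_1],[x_2,r_2])$ for every Borel $A\subset\mathbb R^d$, $i=1,2$. *)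

(* Defs.v *)
From HB Require Import structures.
From mathcomp Require Import all_boot all_order all_algebra generic_quotient.
From mathcomp Require Import all_classical all_reals all_analysis measurable_realfun.
Set Implicit Arguments.
Unset Strict Implicit.
Unset Printing Implicit Defensive.
Import Order.TTheory GRing.Theory Num.Theory.
Import numFieldNormedType.Exports.
Local Open Scope classical_set_scope.
Local Open Scope ring_scope.
Local Open Scope quotient_scope.

Notation borel T := (g_sigma_algebraType (@open T)).

Section borel_theory.
Context {T S : ptopologicalType}.

Lemma open_borel (U : set T) : open U -> measurable (U : set (borel T)).
Proof. exact: sub_sigma_algebra. Qed.

Lemma continuous_borel (f : T -> S) : continuous f ->
  measurable_fun [set: borel T] (f : borel T -> borel S).
Proof.
move=> cf; have := @measurability _ _ (borel T) (borel S) setT f (@open S) erefl; apply.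
move=> _ [B oB <-]; rewrite setTI; apply: open_borel.
by move/continuousP : cf; apply.
Qed.

Lemma continuous_borelR (R : realType) (f : T -> R) : continuous f ->
  measurable_fun [set: borel T] (f : borel T -> R).
Proof.
move=> cf.
refine (@measurability _ _ (borel T) R setT f _ (RGenOInfty.measurableE R) _).
move=> _ [_ [a ->] <-]; rewrite setTI; apply: open_borel.
by move/continuousP : cf; apply; exact: interval_open.
Qed.

End borel_theory.

Section row_cons.
Context (R : realType) (n : nat).

Definition row_cons (p : R * borel 'rV[R]_n) : borel 'rV[R]_n.+1 :=
  \row_(j < n.+1) if unlift ord0 j is Some k then (p.2 : 'rV_n) ord0 k else p.1.

Definition row_uncons (v : borel 'rV[R]_n.+1) : R * borel 'rV[R]_n :=
  (v ord0 ord0, \row_(k < n) v ord0 (lift ord0 k)).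

Lemma row_cons0 p i : row_cons p i ord0 = p.1.
Proof. by rewrite /row_cons mxE unlift_none. Qed.

Lemma row_consS p i k : row_cons p i (lift ord0 k) = (p.2 : 'rV_n) i k.
Proof. by rewrite /row_cons mxE liftK (ord1 i). Qed.

Lemma row_consK : cancel row_cons row_uncons.
Proof.
move=> p; rewrite /row_uncons row_cons0 [RHS]surjective_pairing; congr pair.
by apply/rowP => k; rewrite mxE row_consS.
Qed.

Lemma row_unconsK : cancel row_uncons row_cons.
Proof.
move=> v; apply/rowP => j; case: (unliftP ord0 j) => [k|] ->.
  by rewrite row_consS mxE.
by rewrite row_cons0.
Qed.

Lemma row_rat_ball (U : set 'rV[R]_n) (v : 'rV[R]_n) : open U -> U v ->
  exists q : 'rV[rat]_n * nat, let B := ball (map_mx ratr q.1 : 'rV[R]_n) q.2.+1%:R^-1 in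
    B v /\ B `<=` U.
Proof.
move=> oU Uv.
have /nbhs_ballP[e /= e0 eU] : nbhs v U by exact: open_nbhs_nbhs.
have [k _ ke] : exists2 k : nat, True & k.+1%:R^-1 < e / 2.
  have [k _ /(_ k)] : \forall k \near \oo, k.+1%:R^-1 < e / 2.
    by apply: near_infty_natSinv_lt (PosNum (divr_gt0 e0 (ltr0Sn _ 1))).
  by move=> /(_ (leqnn k)); exists k.
pose k1 : R := k.+1%:R^-1.
have k0 : 0 < k1 by rewrite invr_gt0.
have H j : exists q : rat, `|ratr q - v ord0 j| < k1.
  have /rat_in_itvoo[q] : v ord0 j - k1 < v ord0 j + k1 by rewrite ltrD2l gtrN.
  by rewrite in_itv /= -ltr_distlC distrC => ?; exists q.
pose q := \row_j projT1 (cid (H j)).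
have qv : ball (map_mx ratr q : 'rV[R]_n) k1 v.
  by split=> // i j; rewrite !mxE (ord1 i); case: cid.
exists (q, k); split => //= w /ball_sym qw; apply: eU.
have : ball v (k1 + k1) w.
  apply: ball_triangle; first exact: (ball_sym qv).
  exact: (ball_sym qw).
by apply: le_ball; rewrite (splitr e) lerD// ltW.
Qed.

End row_cons.

Lemma measurable_row_cons (R : realType) n :
  measurable_fun [set: R * borel 'rV[R]_n] (@row_cons R n).
Proof.
refine (@measurability _ _ _ (borel 'rV[R]_n.+1) setT (@row_cons R n)
  (@open 'rV[R]_n.+1) erefl _).
move=> _ [U oU <-]; rewrite setTI.
pose D (q : 'rV[rat]_n.+1 * nat) : set 'rV[R]_n.+1 :=
  let B := ball (map_mx ratr q.1 : 'rV[R]_n.+1) q.2.+1%:R^-1 in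
  [set v | B v /\ B `<=` U].
have -> : U = \bigcup_q D q.
  rewrite eqEsubset; split => [v Uv|v [q _ [Bv BU]]]; last exact: BU.
  by have [q /= [? ?]] := row_rat_ball oU Uv; exists q.
rewrite preimage_bigcup; apply: countable_bigcupT_measurable => //= q.
pose B : set 'rV[R]_n.+1 := ball (map_mx ratr q.1 : 'rV[R]_n.+1) q.2.+1%:R^-1.
have [BU|BU] := pselect (B `<=` U); last first.
  rewrite (_ : _ @^-1` _ = set0)//.
  by rewrite -subset0 => p [_ /BU].
pose e : R := q.2.+1%:R^-1; pose c := map_mx ratr q.1 : 'rV[R]_n.+1.
rewrite (_ : _ @^-1` _ = ball (row_uncons c).1 e `*`
    ball ((row_uncons c).2 : 'rV[R]_n) e); last first.
  rewrite eqEsubset; split=> p.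
    move=> [[e0 Bp] _]; split=> /=.
      by have := Bp ord0 ord0; rewrite row_cons0.
    split=> // i k; have := Bp ord0 (lift ord0 k); rewrite row_consS [in X in _ -> X]mxE.
    rewrite (ord1 i).
    exact.
  move=> [/= B1 [e0 B2]]; split=> //; split => // i j; rewrite (ord1 i).
  case: (unliftP ord0 j) => [k|] ->; last by rewrite row_cons0.
  by rewrite row_consS; have := B2 ord0 k; rewrite mxE.
apply: measurableX; first by apply: open_measurable; exact: ball_open.
by apply: open_borel; exact: ball_open.
Qed.

Lemma continuous_row_tail (R : realType) n :
  continuous (fun v : 'rV[R]_n.+1 => (row_uncons v).2 : 'rV[R]_n).
Proof.
move=> v A [P vP PA].
exists (fun i j => if unlift ord0 j is Some k then P i k else setT).
  move=> i j; case: (unliftP ord0 j) => [k|] ->; last exact: filterT.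
  by have := vP i k; rewrite mxE (ord1 i).
move=> w Pw; apply: PA => i k; rewrite mxE (ord1 i).
by have := Pw ord0 (lift ord0 k); rewrite liftK.
Qed.

Lemma measurable_row_uncons (R : realType) n :
  measurable_fun [set: borel 'rV[R]_n.+1] (@row_uncons R n).
Proof.
apply/measurable_fun_pairP; split.
  by apply: (@continuous_borelR 'rV[R]_n.+1 R); exact: coord_continuous.
apply: (@continuous_borel 'rV[R]_n.+1 'rV[R]_n).
exact: continuous_row_tail.
Qed.

Section lebesgue_step.
Local Open Scope ereal_scope.
Context (R : realType) (n : nat).
Variable m : {sigma_finite_measure set (borel 'rV[R]_n) -> \bar R}.

Definition lebesgue_step : set (borel 'rV[R]_n.+1) -> \bar R :=
  pushforward (lebesgue_measure \x m) (@row_cons R n).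

Let lebesgue_step0 : lebesgue_step set0 = 0.
Proof. by rewrite /lebesgue_step /pushforward preimage_set0 measure0. Qed.

Let lebesgue_step_ge0 A : 0 <= lebesgue_step A.
Proof. exact: (measure_ge0 (lebesgue_measure \x m)). Qed.

Let measurable_preimage_row_cons A : measurable A ->
  measurable (@row_cons R n @^-1` A).
Proof. by move=> mA; rewrite -[X in measurable X]setTI; exact: measurable_row_cons. Qed.

Let lebesgue_step_sigma_additive : semi_sigma_additive lebesgue_step.
Proof.
move=> F mF tF mUF; rewrite /lebesgue_step /pushforward preimage_bigcup.
apply: measure_semi_sigma_additive.
- by move=> k; exact: measurable_preimage_row_cons.
- apply/trivIsetP => /= i j _ _ ij; rewrite -preimage_setI.
  by move/trivIsetP : tF => /(_ _ _ _ _ ij) ->//; rewrite preimage_set0.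
- by rewrite -preimage_bigcup; exact: measurable_preimage_row_cons.
Qed.

HB.instance Definition _ := isMeasure.Build _ _ _ lebesgue_step
  lebesgue_step0 lebesgue_step_ge0 lebesgue_step_sigma_additive.

Let lebesgue_step_sigma_finite : sigma_finite setT lebesgue_step.
Proof.
have /sigma_finiteP[F [FT ndF Foo]] := sigma_finiteT (@lebesgue_measure R).
have /sigma_finiteP[G [GT ndG Goo]] := sigma_finiteT m.
exists (fun k => @row_uncons R n @^-1` (F k `*` G k)) => [|k].
  rewrite -preimage_bigcup -[LHS](@preimage_setT _ _ (@row_uncons R n)).
  congr (_ @^-1` _); rewrite -setXTT FT GT predeqE => -[x y]; split.
    move=> [/= [i _ Fx] [j _ Gy]]; exists (maxn i j) => //; split => /=.
    - by move: x Fx; exact/subsetPset/ndF/leq_maxl.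
    - by move: y Gy; exact/subsetPset/ndG/leq_maxr.
  by move=> [i _ []/= ? ?]; split; exists i.
have [mF mFoo] := Foo k; have [mG mGoo] := Goo k; split.
  rewrite -[X in measurable X]setTI; apply: measurable_row_uncons => //.
  exact: measurableX.
rewrite /lebesgue_step /pushforward -comp_preimage.
rewrite (_ : _ \o _ = id) ?preimage_id; last by apply/funext => p /=; rewrite row_consK.
by rewrite product_measure1E// lte_mul_pinfty// ge0_fin_numE.
Qed.

HB.instance Definition _ := Measure_isSigmaFinite.Build _ _ _ lebesgue_step
  lebesgue_step_sigma_finite.

End lebesgue_step.

(* Lebesgue measure on 'rV[R]_n by iterated products; in dimension 0 it is the
   unit mass at the only point. *)
Fixpoint lebesgue_rV (R : realType) (n : nat) :
    {sigma_finite_measure set (borel 'rV[R]_n) -> \bar R} :=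
  match n with
  | 0 => @dirac _ (borel 'rV[R]_0) (0 : 'rV[R]_0) R
  | n'.+1 => lebesgue_step (lebesgue_rV R n')
  end.

Lemma lebesgue_rV_box (R : realType) n (a b : 'rV[R]_n) :
  (forall i, a ord0 i <= b ord0 i) ->
  lebesgue_rV R n [set v | forall i, v ord0 i \in `[a ord0 i, b ord0 i]] =
  (\prod_(i < n) (b ord0 i - a ord0 i))%:E.
Proof.
elim: n a b => [|n IH] a b ab.
  rewrite big_ord0 /= diracE mem_set//=.
  by case.
rewrite [X in lebesgue_rV _ _ X](_ : _ =
  @row_uncons R n @^-1` ([set` `[a ord0 ord0, b ord0 ord0]] `*`
    [set v : 'rV[R]_n | forall i,
      v ord0 i \in `[(row_uncons a).2 ord0 i, (row_uncons b).2 ord0 i]])); last first.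
  rewrite eqEsubset; split => v /=.
    by move=> H; split=> [|i]; [exact: H|rewrite !mxE; exact: H].
  move=> [H0 HS] i; case: (unliftP ord0 i) => [k|] -> //.
  by have := HS k; rewrite !mxE.
rewrite /= /lebesgue_step /pushforward -comp_preimage.
rewrite (_ : _ \o _ = id) ?preimage_id; last by apply/funext => p /=; rewrite row_consK.
have mB (c e : 'rV[R]_n) : measurable ([set v : 'rV[R]_n | forall i,
    v ord0 i \in `[c ord0 i, e ord0 i]] : set (borel 'rV[R]_n)).
  rewrite (_ : mkset _ = \bigcap_i
      ((fun v : 'rV[R]_n => v ord0 i) @^-1` [set` `[c ord0 i, e ord0 i]])).
    apply: fin_bigcap_measurable => [|i _]; first exact: finite_finset.
    rewrite -[X in measurable X]setTI.
    by apply: (@continuous_borelR _ R) => //; exact: coord_continuous.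
  by rewrite eqEsubset; split=> v /= H i; [move=> _|]; exact: H.
rewrite product_measure1E//= IH; last by move=> i; rewrite !mxE.
rewrite lebesgue_measure_itv /= lte_fin big_ord_recl EFinM.
congr (_ * _)%E; last by congr EFin; apply: eq_bigr => i _; rewrite !mxE.
have := ab ord0; rewrite le_eqVlt => /predU1P[->|->]; last by rewrite EFinB.
by rewrite ltxx subrr.
Qed.

Definition halfline (R : realType) : Type := set_type [set r : R | 0 <= r].

Section halfline.
Context {R : realType}.

Definition to_halfline (r : R) (r0 : 0 <= r) : halfline R :=
  exist _ r (mem_set r0).

HB.instance Definition _ := Topological.copy (halfline R)
  (set_type [set r : R | 0 <= r]).
HB.instance Definition _ := isPointed.Build (halfline R)
  (to_halfline (lexx 0)).

Definition hval (r : halfline R) : R := sval r.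

Lemma hval_ge0 r : 0 <= hval r.
Proof. by case: r => r /= /set_mem. Qed.

Lemma hval_inj : injective hval.
Proof. exact: val_inj. Qed.

Lemma hval_continuous : continuous hval.
Proof. exact: initial_continuous. Qed.

End halfline.

Section cone.
Context (R : realType) (d : nat).

Local Notation cone_base := ('rV[R]_d * halfline R)%type.

Definition cone_rel (p q : cone_base) : bool :=
  [&& p.1 == q.1, hval p.2 == hval q.2 & hval p.2 != 0] ||
  ((hval p.2 == 0) && (hval q.2 == 0)).

Let cone_rel_refl : reflexive cone_rel.
Proof. by move=> p; rewrite /cone_rel !eqxx andbb /= orNb. Qed.

Let cone_rel_sym : symmetric cone_rel.
Proof.
suff H p q : cone_rel p q -> cone_rel q p by move=> p q; apply/idP/idP; exact: H.
rewrite /cone_rel => /orP[/and3P[/eqP -> /eqP -> ->]|/andP[-> ->]].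
  by rewrite !eqxx.
by rewrite orbT.
Qed.

Let cone_rel_trans : transitive cone_rel.
Proof.
move=> q p r /orP[/and3P[/eqP pq1 /eqP pq2 p0]|/andP[/eqP p0 /eqP q0]];
  rewrite /cone_rel.
  by rewrite pq1 pq2.
by rewrite q0 p0 eqxx /= !andbF.
Qed.

Definition cone_equiv := EquivRel _ cone_rel_refl cone_rel_sym cone_rel_trans.

Definition cone : Type := {eq_quot cone_equiv}.
HB.instance Definition _ := Choice.on cone.
HB.instance Definition _ := EqQuotient.on cone.

Definition cone_class (p : cone_base) : cone := \pi_cone p.

Definition cone_mk (x : 'rV[R]_d) (r : halfline R) : cone := cone_class (x, r).

Definition cone_radius (p : cone) : R := hval (repr p).2.

(* Only meaningful where cone_radius p > 0. *)
Definition cone_point (p : cone) : 'rV[R]_d := (repr p).1.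

Lemma cone_radiusE x r : cone_radius (cone_mk x r) = hval r.
Proof.
rewrite /cone_radius /cone_mk /cone_class; case: piP => q /eqmodP.
by move=> /orP[/and3P[_ /eqP<-]|/andP[/eqP/= -> /eqP ->]].
Qed.

Lemma cone_pointE x r : 0 < hval r -> cone_point (cone_mk x r) = x.
Proof.
rewrite /cone_point /cone_mk /cone_class => r0; case: piP => q /eqmodP.
by move=> /orP[/and3P[/eqP<-]|/andP[/eqP/= re]] //; rewrite re ltxx in r0.
Qed.

Lemma cone_mkP x r y s : cone_mk x r = cone_mk y s <->
  (x = y /\ hval r = hval s /\ hval s != 0) \/ (hval r = 0 /\ hval s = 0).
Proof.
split=> [/eqmodP /orP[/and3P[/eqP /= -> /eqP -> ?]|/andP[/eqP -> /eqP ->]]|H].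
- by left.
- by right.
apply/eqmodP; rewrite /= /cone_equiv /= /cone_rel /=.
by move: H => [[-> [-> ->]]|[-> ->]]; rewrite !eqxx ?orbT.
Qed.

Lemma cone_reprK p : cone_class (repr p) = p.
Proof. exact: reprK. Qed.

Lemma cone_radius_ge0 p : 0 <= cone_radius p.
Proof. exact: hval_ge0. Qed.

(* This is coarser than the quotient topology at the vertex. *)
Definition cone_nbhs (p : cone) : set_system cone := [set A |
  if cone_radius p == 0
  then exists2 e : R, 0 < e & [set q | cone_radius q < e] `<=` A
  else exists2 N, nbhs (repr p : cone_base) N & cone_class @` N `<=` A].

HB.instance Definition _ := hasNbhs.Build cone cone_nbhs.

Let cone_nbhs_filter (p : cone) : ProperFilter (nbhs p).
Proof.
rewrite /nbhs /= /cone_nbhs; case: eqVneq => p0.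
  split; last split.
  - by move=> [e e0 /(_ p)]; apply; rewrite /= p0.
  - by exists 1.
  - move=> A B [e e0 eA] [f f0 fB]; exists (Num.min e f); first by rewrite lt_min e0.
    by move=> q /=; rewrite lt_min => /andP[qe qf]; split; [exact: eA|exact: fB].
  - by move=> A B AB [e e0 eA]; exists e => // q /eA /AB.
split; last split.
- move=> [N pN /(_ p)]; apply => /=; exists (repr p); last exact: cone_reprK.
  exact: nbhs_singleton pN.
- by exists setT => //; exact: filterT.
- move=> A B [N pN NA] [M pM MB]; exists (N `&` M); first exact: filterI.
  by move=> _ [q [Nq Mq] <-]; split; [apply: NA|apply: MB]; exists q.
- by move=> A B AB [N pN NA]; exists N => // q /NA /AB.
Qed.

Let cone_nbhs_singleton (p : cone) (A : set cone) : nbhs p A -> A p.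
Proof.
rewrite /nbhs /= /cone_nbhs /=; case: eqVneq => p0.
  by move=> [e e0]; apply; rewrite /= p0.
move=> [N pN]; apply => /=; exists (repr p); last exact: cone_reprK.
exact: nbhs_singleton pN.
Qed.

Let radius_nbhs (U : set R) (p : cone_base) : open U -> U (hval p.2) ->
  nbhs p [set q : cone_base | U (hval q.2)].
Proof.
move=> oU Up.
have c : continuous (fun q : cone_base => hval q.2).
  by move=> q; apply: continuous_comp; [exact: cvg_snd|exact: hval_continuous].
by apply: c; exact: open_nbhs_nbhs.
Qed.

Let radius_class q : cone_radius (cone_class q) = hval q.2.
Proof. by rewrite -(cone_radiusE q.1 q.2) /cone_mk -surjective_pairing. Qed.

Let class_repr q : hval q.2 != 0 -> repr (cone_class q) = q.
Proof.
move=> q0; have : cone_class (repr (cone_class q)) = cone_class q.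
  exact: cone_reprK.
move=> /eqmodP /orP[/and3P[/eqP e1 /eqP /hval_inj e2 _]|/andP[_ /eqP q0']].
  by rewrite [LHS]surjective_pairing [RHS]surjective_pairing e1 e2.
by rewrite q0' eqxx in q0.
Qed.

Let cone_nbhs_nbhs (p : cone) (A : set cone) : nbhs p A -> nbhs p (nbhs^~ A).
Proof.
rewrite {1 2}/nbhs /= /cone_nbhs /=; case: eqVneq => p0.
  move=> [e e0 eA]; exists e => // q qe; rewrite /nbhs /= /cone_nbhs /=.
  case: eqVneq => q0; first by exists e.
  exists [set r : cone_base | hval r.2 < e].
    by apply: (@radius_nbhs [set x | x < e]) => //; exact: open_lt.
  by move=> _ [r /= re <-]; apply: eA; rewrite /= radius_class.
move=> [N pN NA].
exists (interior N `&` [set r | hval r.2 != 0]).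
  apply: filterI; first exact: nbhs_interior.
  by apply: (@radius_nbhs [set x | x != 0]) => //; exact: open_neq.
move=> _ [q [Nq q0] <-]; rewrite /nbhs /= /cone_nbhs /= radius_class.
by rewrite (negbTE q0) class_repr//; exists N.
Qed.

HB.instance Definition _ := Nbhs_isNbhsTopological.Build cone
  cone_nbhs_filter cone_nbhs_singleton cone_nbhs_nbhs.

HB.instance Definition _ := isPointed.Build cone (cone_mk 0 (to_halfline (lexx 0))).

End cone.

Section unbalanced_transport.
Local Open Scope ereal_scope.
Context (R : realType) (d : nat).

Definition cone_plan (mu1 mu2 : set (borel 'rV[R]_d) -> \bar R)
    (alpha : {finite_measure set (borel (cone R d * cone R d)%type) -> \bar R}) :=
  [/\ \int[alpha]_p (cone_radius p.1 + cone_radius p.2)%:E < +oo,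
      forall A : set (borel 'rV[R]_d), measurable A ->
        mu1 A = \int[alpha]_(p in [set p | (0 < cone_radius p.1)%R /\
                                           A (cone_point p.1)])
                  (cone_radius p.1)%:E &
      forall A : set (borel 'rV[R]_d), measurable A ->
        mu2 A = \int[alpha]_(p in [set p | (0 < cone_radius p.2)%R /\
                                           A (cone_point p.2)])
                  (cone_radius p.2)%:E].

Definition cone_cost (H : cone R d -> cone R d -> R)
    (mu1 mu2 : set (borel 'rV[R]_d) -> \bar R) : \bar R :=
  ereal_inf [set \int[alpha]_p (H p.1 p.2)%:E | alpha in cone_plan mu1 mu2].

Definition transport_growth_map (mu : set (borel 'rV[R]_d) -> \bar R)
    (T : 'rV[R]_d -> 'rV[R]_d) (g : 'rV[R]_d -> halfline R) :=
  measurable_fun [set: borel 'rV[R]_d]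
    ((fun x => (T x, g x)) :
       borel 'rV[R]_d -> borel ('rV[R]_d * halfline R)%type) /\
  mu.-integrable [set: borel 'rV[R]_d] (fun x => (hval (g x))%:E).

Definition density_measure (mu : set (borel 'rV[R]_d) -> \bar R)
    (g : 'rV[R]_d -> halfline R) (A : set (borel 'rV[R]_d)) : \bar R :=
  \int[mu]_(x in A) (hval (g x))%:E.

End unbalanced_transport.

Definition euclid_norm (R : realType) (d : nat) (x : 'rV[R]_d) : R :=
  Num.sqrt (\sum_(i < d) x ord0 i ^+ 2).

Section gaussian_hellinger.
Context (R : realType) (d : nat).

Definition gaussian_H (p q : cone R d) : R :=
  cone_radius p + cone_radius q
  - 2 * Num.sqrt (cone_radius p * cone_radius q)
      * expR (- (euclid_norm (cone_point p - cone_point q) ^+ 2 / 2)).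

Lemma gaussian_HE x1 r1 x2 r2 :
  gaussian_H (cone_mk x1 r1) (cone_mk x2 r2) =
  hval r1 + hval r2
  - 2 * Num.sqrt (hval r1 * hval r2)
      * expR (- (euclid_norm (x1 - x2) ^+ 2 / 2)).
Proof.
rewrite /gaussian_H !cone_radiusE.
have [r10|r10] := ltP 0 (hval r1); last first.
  have -> : hval r1 = 0 by apply: le_anti; rewrite r10 hval_ge0.
  by rewrite mul0r sqrtr0 mulr0 !mul0r.
have [r20|r20] := ltP 0 (hval r2); last first.
  have -> : hval r2 = 0 by apply: le_anti; rewrite r20 hval_ge0.
  by rewrite mulr0 sqrtr0 mulr0 !mul0r.
by rewrite !cone_pointE.
Qed.

End gaussian_hellinger.

(* Main.v *)
Require Import Defs.
From HB Require Import structures.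
From mathcomp Require Import all_boot all_order all_algebra.
From mathcomp Require Import all_classical all_reals all_analysis.
From mathcomp Require Import measurable_realfun ring lra.
Set Implicit Arguments.
Unset Strict Implicit.
Unset Printing Implicit Defensive.
Import Order.TTheory GRing.Theory Num.Theory.
Import numFieldNormedType.Exports.
Local Open Scope classical_set_scope.
Local Open Scope ring_scope.
Local Open Scope ereal_scope.

(** Write k(x,y) = exp(-|x-y|^2), so that the cost of a plan alpha is
    mu1(R^d) + mu2(R^d) - 2 \int sqrt(r1 r2 k(x1,x2)) dalpha.  If two positive
    functions satisfy k(x,y) <= a(x) b(y) everywhere, the arithmetic-geometric
    mean inequality gives 2 sqrt(r1 r2 k(x1,x2)) <= a(x1) r1 + b(x2) r2, so
    every plan costs at least mu1(R^d) + mu2(R^d) - (\int a dmu1 + \int b dmu2)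
    ([weak_duality]).  The map is read off from a pair (a,b) minimising
    \int a dmu1 + \int b dmu2, and it attains this lower bound.

    A minimiser exists without any compactness ([exists_dual_minimizer]): the
    geometric mean of two admissible pairs is admissible, and
    (sqrt a - sqrt a')^2 = a + a' - 2 sqrt(a a'), so the square roots of a
    minimising sequence are Cauchy in L^2.  Replacing the pair by transforms of
    it, one may assume a(x) = sup_y k(x,y)/b(y) and b(y) = sup_x k(x,y)/a(x)
    ([exists_conjugate_optimal]).

    The geometric point is that for mu1-almost every x the points y that nearly
    attain the supremum a(x) accumulate at a single point T(x)
    ([ae_concentrated], [concentrated_at]).  Since
    k(x,y) k(x',y') = k(x,y') k(x',y) exp(2 (x-x').(y-y')), near-maximisers
    depend monotonically on x along each line parallel to a coordinate axis.
    Given two thresholds for the i-th coordinate, a line parallel to the i-th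
    axis therefore contains at most one x having near-maximisers on both sides
    of them, and at most one x whose near-maximisers escape to infinity.  By
    Fubini such points form a Lebesgue-null set ([lebesgue_rV_line_null]); this
    plays the part of the almost everywhere differentiability of the
    potentials, and it is the only use of mu1 << L^d.

    Minimality yields the transport equation.  For U open, dividing a by 1 + t
    where the supremum is not approached off U, and multiplying b by 1 + t on
    U, preserves k <= a b; hence \int_{T^-1 U} a dmu1 <= \int_U b dmu2
    ([optimal_push]).  The total masses agree, so the image of a mu1 under T is
    b mu2.  Moreover a(x) b(T(x)) = k(x,T(x)) ([maximizer_contact]).  With
    g = a / (b o T) the image of g mu1 is mu2 ([growth_push]) and the cost
    density of the map is 1 + g - 2 a ([growth_contact]), whose integral is
    mu1(R^d) + mu2(R^d) - \int a dmu1 - \int b dmu2 ([map_cost]). *)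

(** * Weighted and image measures *)

Section weighted_measure.
Context d (T : measurableType d) (R : realType).
Variables (mu : {measure set T -> \bar R}) (w : T -> R).
Hypotheses (mw : measurable_fun setT w) (w0 : forall x, (0 <= w x)%R).

(** The two proofs are arguments so that a measure structure can be attached to
    this set function. *)
Definition weighted of measurable_fun setT w & (forall x, 0 <= w x)%R :=
  fun A : set T => \int[mu]_(x in A) (w x)%:E.

Local Notation nu := (weighted mw w0).

Let nu0 : nu set0 = 0. Proof. exact: integral_set0. Qed.

Let nu_ge0 A : 0 <= nu A.
Proof. by apply: integral_ge0 => x _; rewrite lee_fin. Qed.

Let nu_sigma_additive : semi_sigma_additive nu.
Proof.
apply: semi_sigma_additive_nng_induced; first exact/measurable_EFinP.
by move=> x; rewrite lee_fin.
Qed.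

HB.instance Definition _ :=
  isMeasure.Build _ _ _ nu nu0 nu_ge0 nu_sigma_additive.

Import HBNNSimple.

(** Both sides are monotone limits along simple functions, and for the
    indicator of a set the identity is the definition of the weighted measure. *)
Lemma integral_weighted (f : T -> \bar R) :
  measurable_fun setT f -> (forall x, 0 <= f x) ->
  \int[nu]_x f x = \int[mu]_x (f x * (w x)%:E).
Proof.
move=> mf f0; pose h := nnsfun_approx measurableT mf.
have hf x : (EFin \o h n) x @[n --> \oo] --> f x.
  exact: (cvg_nnsfun_approx measurableT mf).
have mh n : measurable_fun setT (EFin \o h n).
  by apply/measurable_EFinP; exact: measurable_funP.
have mwE : measurable_fun setT (EFin \o w) by exact/measurable_EFinP.
have nndh x : {homo (fun n => (EFin \o h n) x) : n m / (n <= m)%N >-> n <= m}.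
  by move=> a b ab; rewrite lee_fin; exact/lefP/nd_nnsfun_approx.
transitivity (limn (fun n => \int[nu]_x (EFin \o h n) x)).
  rewrite -monotone_convergence//.
  - by apply: eq_integral => x _; exact/esym/cvg_lim/hf.
  - by move=> n x _; rewrite lee_fin.
transitivity (limn (fun n => \int[mu]_x ((EFin \o h n) x * (w x)%:E))); last first.
  rewrite -monotone_convergence//.
  - by apply: eq_integral => x _; apply/cvg_lim => //; apply: cvgeZr.
  - by move=> n; apply: emeasurable_funM.
  - by move=> n x _; rewrite mule_ge0// lee_fin.
  - by move=> x _ a b ab; rewrite lee_wpmul2r ?lee_fin//; exact: nndh.
apply: congr_lim; apply/funext => n; set g := h n.
have mi r : measurable_fun setT (fun x => (r * \1_(g @^-1` [set r]) x)%:E).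
  by apply/measurable_EFinP; exact: measurable_funM.
transitivity (\int[nu]_x (\sum_(y \in range g) (y * \1_(g @^-1` [set y]) x)%:E)).
  by apply: eq_integral => x _; rewrite /= fimfunE -fsumEFin.
transitivity (\int[mu]_x (\sum_(y \in range g)
    ((y * \1_(g @^-1` [set y]) x)%:E * (w x)%:E))); last first.
  apply: eq_integral => x _; rewrite -ge0_mule_fsuml; last first.
    by move=> y; exact: nnfun_muleindic_ge0.
  by rewrite fsumEFin// -(fimfunE _ x).
rewrite !ge0_integral_fsum//; last 3 first.
- by move=> y; apply: emeasurable_funM.
- by move=> y x _; apply: mule_ge0; [exact: nnfun_muleindic_ge0|rewrite lee_fin].
- by move=> y x _; exact: nnfun_muleindic_ge0.
apply: eq_fsbigr => r /[!inE] -[x0 _ <-{r}].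
under eq_integral do rewrite EFinM.
rewrite ge0_integralZl ?lee_fin//; last by apply/measurable_EFinP.
under [RHS]eq_integral do rewrite EFinM -muleA.
rewrite ge0_integralZl ?lee_fin//; last 2 first.
- by apply: emeasurable_funM => //; exact/measurable_EFinP.
- by move=> x _; rewrite mule_ge0 ?lee_fin.
congr (_ * _); rewrite integral_indic// setIT [LHS]integral_mkcond.
by apply: eq_integral => x _; rewrite epatch_indic/= muleC.
Qed.

End weighted_measure.

Section image_measure.
Context d1 d2 (T1 : measurableType d1) (T2 : measurableType d2) (R : realType).
Variables (f : T1 -> T2) (mf : measurable_fun setT f).

Section measure.
Variable mu : {measure set T1 -> \bar R}.

(** The proof of measurability is an argument so that measure and finiteness
    structures can be attached to this set function. *)
Definition image_measure of measurable_fun setT f := pushforward mu f.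

Local Notation nu := (image_measure mf).

Let nu0 : nu set0 = 0. Proof. exact: measure0. Qed.

Let nu_ge0 A : 0 <= nu A. Proof. exact: measure_ge0. Qed.

Let mpre A : measurable A -> measurable (f @^-1` A).
Proof. by move=> mA; rewrite -[X in measurable X]setTI; exact: mf. Qed.

Let nu_sigma_additive : semi_sigma_additive nu.
Proof.
move=> F mF tF mUF; rewrite /image_measure /pushforward preimage_bigcup.
apply: measure_semi_sigma_additive.
- by move=> n; exact: mpre.
- apply/trivIsetP => /= i j _ _ ij; rewrite -preimage_setI.
  by move/trivIsetP : tF => /(_ _ _ _ _ ij) ->//; rewrite preimage_set0.
- by rewrite -preimage_bigcup; exact: mpre.
Qed.

HB.instance Definition _ :=
  isMeasure.Build _ _ _ nu nu0 nu_ge0 nu_sigma_additive.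

End measure.

Variable mu : {finite_measure set T1 -> \bar R}.

Let image_fin : fin_num_fun (image_measure mu mf).
Proof.
move=> A mA; apply: (fin_num_measure mu).
by rewrite -[X in measurable X]setTI; exact: mf.
Qed.

HB.instance Definition _ :=
  Measure_isFinite.Build _ _ _ (image_measure mu mf) image_fin.

End image_measure.

(** On closed sets the inequality between the measures is reversed, by passing
    to complements.  An open set is the increasing union of the closed sets of
    points at distance at least 1/(n+1) from its complement, so the measures
    agree on open sets, which generate the Borel sets and are stable under
    intersection. *)
Lemma eq_finite_measure_open (R : realType) d
    (P Q : {measure set (borel 'rV[R]_d) -> \bar R}) :
  (forall U : set 'rV[R]_d, open U -> P U <= Q U) -> Q setT <= P setT ->
  P setT < +oo -> forall A, measurable A -> P A = Q A.
Proof.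
move=> PQ QP Poo.
have PQT : P setT = Q setT by apply/eqP; rewrite eq_le QP andbT PQ//; exact: openT.
have Qoo : Q setT < +oo by rewrite -PQT.
have mO (U : set 'rV[R]_d) : open U -> measurable (U : set (borel 'rV[R]_d)).
  exact: open_borel.
have closedPQ (U : set 'rV[R]_d) : open U -> Q (~` U) <= P (~` U).
  move=> oU; have mU := mO _ oU.
  rewrite -!setTD (measureD measurableT mU Poo) (measureD measurableT mU Qoo).
  by rewrite !setTI; apply: leeB; [exact: QP|exact: PQ].
have openPQ (U : set 'rV[R]_d) : open U -> P U = Q U.
  move=> oU; apply/eqP; rewrite eq_le PQ//=.
  pose F (n : nat) : set (borel 'rV[R]_d) :=
    ~` (\bigcup_(z in ~` U) ball z n.+1%:R^-1%R).
  have oF n : open (\bigcup_(z in ~` U) ball z (n.+1%:R^-1 : R)%R).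
    by apply: bigcup_open => z _; exact: ball_open.
  have mF n : measurable (F n) by apply: measurableC; exact: mO.
  have ndF : nondecreasing_seq F.
    move=> m n mn; apply/subsetPset; apply: subsetC => x [z Uz zx]; exists z => //.
    apply: le_ball zx; rewrite lef_pV2 ?posrE//.
    by rewrite ler_nat.
  have UF : U = \bigcup_n F n.
    apply/seteqP; split=> [x Ux|x [n _ Fx]].
      have /nbhs_ballP[e /= e0 eU] : nbhs x U by exact: open_nbhs_nbhs.
      have [n _ /(_ n (leqnn n)) ne] : \forall n \near \oo, (n.+1%:R^-1 < e)%R.
        exact: near_infty_natSinv_lt (PosNum e0).
      exists n => // -[z Uz zx]; apply: Uz; apply: eU; apply: le_ball (ltW ne) _ _.
      exact: ball_sym.
    apply: contrapT => Ux; apply: Fx; exists x => //; apply: ballxx.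
    by rewrite invr_gt0.
  have mUF : measurable (\bigcup_n F n) by exact: bigcup_measurable.
  have cP := nondecreasing_cvg_mu (mu := P) mF mUF ndF.
  have cQ := nondecreasing_cvg_mu (mu := Q) mF mUF ndF.
  rewrite [in leLHS]UF [in leRHS]UF -(cvg_lim _ cP)// -(cvg_lim _ cQ)//.
  apply: lee_lim; [exact: cvgP cQ|exact: cvgP cP|].
  by apply: nearW => n; exact: closedPQ.
move=> A mA.
apply: (@measure_unique _ R (borel 'rV[R]_d) (@open 'rV[R]_d) (fun=> setT) erefl _ _ _ P Q) => //.
- exact: openI.
- by move=> _; exact: openT.
- by rewrite bigcup_const//; exists 0%N.
Qed.

(** * Existence of a minimiser of the dual problem *)

Section root_gap.
Context d (X : measurableType d) (R : realType).
Variable mu : {finite_measure set X -> \bar R}.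
Implicit Types a b : X -> \bar R.

(** This is +oo as soon as r or s is: the difference +oo - +oo is -oo, whose
    absolute value is +oo.  A finite gap thus records that both are finite. *)
Definition root_gap (r s : \bar R) : \bar R := `|sqrte r - sqrte s|.

Lemma measurable_sqrte a : measurable_fun setT a -> (forall x, 0 <= a x) ->
  measurable_fun setT (fun x => sqrte (a x)).
Proof.
move=> ma a0; rewrite (_ : (fun x => _) = (fun x => a x `^ 2^-1)); last first.
  by apply/funext => x; rewrite poweR12_sqrt.
exact: (measurableT_comp (measurable_poweR _) ma).
Qed.

Lemma measurable_root_gap a b : measurable_fun setT a -> measurable_fun setT b ->
  (forall x, 0 <= a x) -> (forall x, 0 <= b x) ->
  measurable_fun setT (fun x => root_gap (a x) (b x)).
Proof.
by move=> *; apply: measurableT_comp => //; apply: emeasurable_funB;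
  apply: measurable_sqrte.
Qed.

Lemma root_gap_ge0 r s : 0 <= root_gap r s. Proof. exact: abse_ge0. Qed.

(** An equality between finite numbers.  It is the parallelogram identity for
    square roots, the geometric mean playing the part of the midpoint. *)
Lemma root_gap_sqr (r s : \bar R) : 0 <= r -> 0 <= s ->
  sqrte (r * s) + sqrte (r * s) + root_gap r s ^+ 2 <= r + s.
Proof.
move: r s => [r| |] [s| |] // r0 s0; rewrite ?leey//.
rewrite !lee_fin in r0 s0.
rewrite /root_gap expe2 /= lee_fin -expr2 real_normK ?num_real// sqrtrM//.
by rewrite -[leRHS](congr2 +%R (sqr_sqrtr r0) (sqr_sqrtr s0)); lra.
Qed.

Lemma root_gap_lty r s : 0 <= r -> 0 <= s -> root_gap r s < +oo ->
  r < +oo /\ s < +oo.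
Proof. by move: r s => [r| |] [s| |]//= r0 s0; rewrite !ltry. Qed.

(** A finite sum forces every u n to be finite, and then the sequence of square
    roots has finite variation. *)
Lemma summable_root_gap_cvg (u : (\bar R)^nat) : (forall n, 0 <= u n) ->
  \sum_(n <oo) root_gap (u n) (u n.+1) < +oo ->
  exists2 l : R, (0 <= l)%R & u n @[n --> \oo] --> l%:E.
Proof.
move=> u0 uoo.
have ufin n : u n = (fine (u n))%:E.
  rewrite fineK// ge0_fin_numE//.
  apply: (root_gap_lty (u0 n) (u0 n.+1) _).1; apply: le_lt_trans uoo.
  rewrite (nneseriesD1 (n := n))// => [|k _]; last exact: root_gap_ge0.
  by rewrite leeDl//; apply: nneseries_ge0 => *; exact: root_gap_ge0.
pose w n : R := Num.sqrt (fine (u n)).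
have cw : cvgn w.
  rewrite (_ : w = (fun n => w 0%N + series (telescope w) n)%R); last first.
    by apply/funext => n; exact: eq_sum_telescope.
  apply: is_cvgD; first exact: is_cvg_cst.
  apply: (@normed_cvg _ R^o); apply: nondecreasing_is_cvgn.
    by apply: nondecreasing_series => *; exact: normr_ge0.
  exists (fine (\sum_(n <oo) root_gap (u n) (u n.+1))) => _ [n _ <-].
  rewrite -lee_fin fineK; last first.
    by rewrite ge0_fin_numE//; apply: nneseries_ge0 => *; exact: root_gap_ge0.
  rewrite /series /= -sumEFin.
  apply: le_trans (nneseries_lim_ge n _); last by move=> *; exact: root_gap_ge0.
  apply: lee_sum => i _; rewrite /root_gap (ufin i) (ufin i.+1)/=.
  by rewrite lee_fin /telescope/= distrC.
exists (limn w ^+ 2)%R; first exact: sqr_ge0.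
rewrite (_ : u = EFin \o (fun n => w n ^+ 2)%R); last first.
  by apply/funext => n; rewrite /= sqr_sqrtr -?ufin// fine_ge0.
by apply: cvg_EFin; [exact: nearW|exact: (cvgM cw cw)].
Qed.

Lemma measure_infinite_integrand (f : X -> \bar R) :
  measurable_fun setT f -> (forall x, 0 <= f x) -> \int[mu]_x f x < +oo ->
  mu (~` [set x | f x < +oo]) = 0.
Proof.
move=> mf f0 f_fin.
have [||N [mN N0 sN]] := @integrable_ae _ _ _ mu setT _ f; first by [].
  apply/integrableP; split=> //.
  by under eq_integral => x _ do rewrite gee0_abs//.
apply: (subset_measure0 _ mN _ N0).
  by apply: measurableC; rewrite -[X in measurable X]setTI;
    exact: emeasurable_fun_infty_o.
by move=> x /= fx; apply: sN => /(_ Logic.I) ffin; apply: fx; rewrite -ge0_fin_numE.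
Qed.

(** Pointwise, a gap e satisfies e <= 2^n e^2 + 2^-n; so the integrals of the
    gaps decay geometrically, and the sum of the gaps has a finite integral. *)
Lemma ae_summable_root_gap (a : (X -> \bar R)^nat) (C : R) : (0 <= C)%R ->
  (forall n, measurable_fun setT (a n)) -> (forall n x, 0 <= a n x) ->
  (forall n, \int[mu]_x root_gap (a n x) (a n.+1 x) ^+ 2 <= (C / 4 ^+ n)%:E) ->
  let S := [set x | \sum_(n <oo) root_gap (a n x) (a n.+1 x) < +oo] in
  measurable S /\ mu (~` S) = 0.
Proof.
move=> C0 ma a0 aC S; pose e n x := root_gap (a n x) (a n.+1 x).
pose e2 n x := e n x ^+ 2.
have me n : measurable_fun setT (e n) by exact: measurable_root_gap.
have e0 n x : 0 <= e n x by exact: root_gap_ge0.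
have me2 n : measurable_fun setT (e2 n) by exact: emeasurable_funM.
have e20 n x : 0 <= e2 n x by exact: expe_ge0.
have mse : measurable_fun setT (fun x => \sum_(n <oo) e n x).
  by apply: ge0_emeasurable_sum => //; move=> k x _ _; exact: e0.
have se0 x : 0 <= \sum_(n <oo) e n x by apply: nneseries_ge0 => *; exact: e0.
have mS : measurable S.
  by rewrite -[S]setTI; exact: emeasurable_fun_infty_o.
split => //.
pose M := fine (mu setT).
have M0 : (0 <= M)%R by rewrite fine_ge0.
have eM n : \int[mu]_x e n x <= ((C + M) *+ 2 / (2 ^ n.+1)%:R)%:E.
  have p2 : (0 < 2 ^+ n :> R)%R by rewrite exprn_gt0.
  apply: (@le_trans _ _ (\int[mu]_x ((2 ^+ n)%:E * e2 n x + (2 ^- n)%:E))).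
    apply: ge0_le_integral => //.
    - by apply: emeasurable_funD => //; apply: measurable_funeM.
    - move=> x _; rewrite /e2; case: (e n x) (e0 n x) => [r| |]// r0; last first.
        by rewrite expe2 mulyy gt0_muley ?lte_fin// addye// leey.
      rewrite expe2 /= lee_fin.
      (* after multiplication by 2^n the claim is u <= u^2 + 1 for u = 2^n r *)
      have := sqr_ge0 (2 ^+ n * r - 2^-1)%R.
      by rewrite -(ler_pM2l p2) mulrDr divff ?gt_eqF//; nra.
  have pe20 x : 0 <= (2 ^+ n)%:E * e2 n x by rewrite mule_ge0// lee_fin ltW.
  have mpe2 : measurable_fun setT (fun x => (2 ^+ n)%:E * e2 n x).
    exact: measurable_funeM.
  have p2V : 0 <= (2 ^- n)%:E :> \bar R by rewrite lee_fin invr_ge0 ltW.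
  rewrite ge0_integralD//.
  rewrite (ge0_integralZl_EFin _ _ (f1 := e2 n)) ?(ltW p2)//.
  rewrite integral_cst// (_ : _ setT = M%:E); last by rewrite fineK// fin_num_measure.
  apply: (@le_trans _ _ ((2 ^+ n)%:E * (C / 4 ^+ n)%:E + (2 ^- n)%:E * M%:E)).
    by apply: leeD2r; apply: lee_wpmul2l; [rewrite lee_fin ltW|exact: aC].
  rewrite -!EFinM -EFinD lee_fin le_eqVlt; apply/orP; left; apply/eqP.
  rewrite natrX exprS (_ : 4 = 2 * 2 :> R)%R; last by rewrite -natrM.
  by rewrite exprMn mulr2n; field; rewrite gt_eqF.
have int_lty : \int[mu]_x \sum_(n <oo) e n x < +oo.
  rewrite integral_nneseries//.
  apply: (@le_lt_trans _ _ ((C + M) *+ 2)%:E); last exact: ltry.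
  apply: le_trans (epsilon_trick0 _ _); last by rewrite mulrn_wge0// addr_ge0.
  by apply: lee_nneseries => [n _ _|n _]; [exact: integral_ge0|exact: eM].
exact: measure_infinite_integrand int_lty.
Qed.

End root_gap.

Section dual_minimizer.
Context d1 d2 (X : measurableType d1) (Y : measurableType d2) (R : realType).
Variables (mu : {finite_measure set X -> \bar R}).
Variables (nu : {finite_measure set Y -> \bar R}) (k : X -> Y -> R).

(** The value +oo is allowed so that a pair satisfying the constraint on sets
    of full measure only can be extended to the whole space. *)
Definition dual_admissible (a : X -> \bar R) (b : Y -> \bar R) :=
  [/\ measurable_fun setT a /\ measurable_fun setT b,
      forall x, 0 <= a x, forall y, 0 <= b y &
      forall x y, (k x y)%:E <= a x * b y].

Definition dual_cost (a : X -> \bar R) (b : Y -> \bar R) :=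
  \int[mu]_x a x + \int[nu]_y b y.

Lemma dual_cost_ge0 a b : dual_admissible a b -> 0 <= dual_cost a b.
Proof. by move=> [_ a0 b0 _]; rewrite adde_ge0// integral_ge0. Qed.

Hypothesis k0 : forall x y, (0 < k x y)%R.

Definition gmean T (a a' : T -> \bar R) t := sqrte (a t * a' t).

(** The constraint is multiplicative, hence stable under geometric means. *)
Lemma dual_admissible_gmean a b a' b' : dual_admissible a b ->
  dual_admissible a' b' -> dual_admissible (gmean a a') (gmean b b').
Proof.
move=> [[ma mb] a0 b0 ab] [[ma' mb'] a0' b0' ab']; split.
- split; apply: measurable_sqrte; try exact: emeasurable_funM.
    by move=> x; exact: mule_ge0.
  by move=> x; exact: mule_ge0.
- by move=> x; exact: sqrte_ge0.
- by move=> x; exact: sqrte_ge0.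
- move=> x y; rewrite /gmean -sqrteM ?mule_ge0// muleACA.
  have kE : (k x y)%:E = sqrte ((k x y)%:E * (k x y)%:E).
    by rewrite -expe2 sqrte_sqr gee0_abs// lee_fin ltW.
  rewrite [leLHS]kE lee_sqrt ?mule_ge0//.
  by rewrite lee_pmul// lee_fin ltW.
Qed.

Lemma integral_root_gap d (T : measurableType d)
    (m : {finite_measure set T -> \bar R}) (a a' : T -> \bar R) :
  measurable_fun setT a -> measurable_fun setT a' ->
  (forall x, 0 <= a x) -> (forall x, 0 <= a' x) ->
  \int[m]_x gmean a a' x + \int[m]_x gmean a a' x +
  \int[m]_x root_gap (a x) (a' x) ^+ 2 <= \int[m]_x a x + \int[m]_x a' x.
Proof.
move=> ma ma' a0 a0'.
have mg : measurable_fun setT (gmean a a').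
  by apply: measurable_sqrte; [exact: emeasurable_funM|move=> x; exact: mule_ge0].
have g0 x : 0 <= gmean a a' x by exact: sqrte_ge0.
have me2 : measurable_fun setT (fun x => root_gap (a x) (a' x) ^+ 2).
  by apply: emeasurable_funM; exact: measurable_root_gap.
have e20 x : 0 <= root_gap (a x) (a' x) ^+ 2 by rewrite expe_ge0// root_gap_ge0.
rewrite -!ge0_integralD//; last 2 first.
- by move=> x _; rewrite adde_ge0.
- exact: emeasurable_funD.
apply: ge0_le_integral => //.
- by move=> x _; rewrite !adde_ge0.
- by apply: emeasurable_funD => //; exact: emeasurable_funD.
- exact: emeasurable_funD.
- by move=> x _; exact: root_gap_sqr.
Qed.

(** By [root_gap_sqr], two near-minimisers are close to each other in L^2 after
    taking square roots, because their geometric mean costs at least c. *)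
Lemma dual_cost_gap (c : \bar R) a b a' b' :
  (forall f g, dual_admissible f g -> c <= dual_cost f g) ->
  dual_admissible a b -> dual_admissible a' b' ->
  c + c + (\int[mu]_x root_gap (a x) (a' x) ^+ 2 +
           \int[nu]_y root_gap (b y) (b' y) ^+ 2)
    <= dual_cost a b + dual_cost a' b'.
Proof.
move=> cmin ab ab'; have cg := cmin _ _ (dual_admissible_gmean ab ab').
case: ab ab' => [[ma mb] a0 b0 _] [[ma' mb'] a0' b0' _].
apply: (@le_trans _ _ ((dual_cost (gmean a a') (gmean b b') +
  dual_cost (gmean a a') (gmean b b')) +
  (\int[mu]_x root_gap (a x) (a' x) ^+ 2 +
   \int[nu]_y root_gap (b y) (b' y) ^+ 2))).
  by rewrite leeD2r// leeD.
rewrite /dual_cost [X in X + _ <= _]addeACA [leLHS]addeACA [leRHS]addeACA.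
by apply: leeD; apply: integral_root_gap.
Qed.

End dual_minimizer.

Section rapid_limit.
Context d (X : measurableType d) (R : realType).
Variable mu : {finite_measure set X -> \bar R}.
Variables (a : (X -> \bar R)^nat) (C : R).
Hypotheses (C0 : (0 <= C)%R) (ma : forall n, measurable_fun setT (a n)).
Hypotheses (a0 : forall n x, 0 <= a n x).
Hypothesis aC : forall n,
  \int[mu]_x root_gap (a n x) (a n.+1 x) ^+ 2 <= (C / 4 ^+ n)%:E.

Definition rapid (x : X) := \sum_(n <oo) root_gap (a n x) (a n.+1 x) < +oo.

(** Setting the value +oo where convergence may fail keeps the constraint
    k <= a b valid there; the inferior limit makes measurability and Fatou's
    lemma available. *)
Definition rapid_limit x := if rapid x then limn_einf (a ^~ x) else +oo.

Let mrapid : measurable [set x | rapid x].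
Proof. by have [] := ae_summable_root_gap C0 ma a0 aC. Qed.

Lemma rapid_limitE x : rapid x ->
  exists l : R, [/\ (0 <= l)%R, a n x @[n --> \oo] --> l%:E & rapid_limit x = l%:E].
Proof.
move=> rx; have [l l0 al] := summable_root_gap_cvg (a0^~ x) rx.
by exists l; split=> //; rewrite /rapid_limit rx; have [] := cvg_limn_einf_sup al.
Qed.

Lemma rapid_limit_ge0 x : 0 <= rapid_limit x.
Proof.
have [/rapid_limitE[l [l0 _ ->]]|nr] := boolP (rapid x); first by rewrite lee_fin.
by rewrite /rapid_limit (negbTE nr).
Qed.

Let mlimn_einf : measurable_fun setT (fun x => limn_einf (a ^~ x)).
Proof.
under eq_fun do rewrite /limn_einf.
apply: measurableT_comp => //; apply: measurable_fun_limn_esup => n.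
exact: measurableT_comp.
Qed.

Lemma measurable_rapid_limit : measurable_fun setT rapid_limit.
Proof.
apply: measurable_fun_ifT => //.
by apply: (measurable_fun_bool true); rewrite setTI.
Qed.

Lemma rapid_nonempty : 0 < mu setT -> exists x, rapid x.
Proof.
move=> mu0; apply: contrapT => /forallNP nr.
have [_] := ae_summable_root_gap C0 ma a0 aC.
rewrite (_ : ~` _ = setT) => [mu00|]; first by rewrite mu00 ltxx in mu0.
by apply/seteqP; split=> // x _; exact: nr.
Qed.

Lemma integral_rapid_limit :
  \int[mu]_x rapid_limit x <= limn_einf (fun n => \int[mu]_x a n x).
Proof.
apply: le_trans (fatou mu measurableT ma (fun n x _ => a0 n x)).
have [_ S0] := ae_summable_root_gap C0 ma a0 aC.
rewrite le_eqVlt; apply/orP; left; apply/eqP.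
apply: ae_eq_integral => //; first exact: measurable_rapid_limit.
exists (~` [set x | rapid x]); split => //; first exact: measurableC.
by move=> x /= xr /= rx; apply: xr => _; rewrite /rapid_limit rx.
Qed.

End rapid_limit.

(** Along a sequence of costs within 4^-n of the infimum, the squared gaps
    between consecutive terms have integral at most 2/4^n by [dual_cost_gap],
    so the sequence converges almost everywhere.  The constraint passes to the
    limit pointwise, and the cost by Fatou's lemma. *)
Theorem exists_dual_minimizer d1 d2 (X : measurableType d1)
    (Y : measurableType d2) (R : realType)
    (mu : {finite_measure set X -> \bar R})
    (nu : {finite_measure set Y -> \bar R}) (k : X -> Y -> R) :
  (forall x y, (0 < k x y)%R) -> 0 < mu setT -> 0 < nu setT ->
  (exists a b, dual_admissible k a b /\ dual_cost mu nu a b < +oo) ->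
  exists a b, dual_admissible k a b /\
    forall f g, dual_admissible k f g ->
      dual_cost mu nu a b <= dual_cost mu nu f g.
Proof.
move=> k0 mu0 nu0 [a1 [b1 [ab1 J1oo]]].
pose c := ereal_inf [set dual_cost mu nu p.1 p.2 |
                      p in [set p | dual_admissible k p.1 p.2]].
have cmin f g : dual_admissible k f g -> c <= dual_cost mu nu f g.
  by move=> fg; apply: ereal_inf_lbound; exists (f, g).
have c0 : 0 <= c.
  by apply: le_ereal_inf_tmp => _ [p pa <-]; exact: dual_cost_ge0 pa.
have cfin : c \is a fin_num.
  by rewrite ge0_fin_numE// (le_lt_trans _ J1oo)// cmin.
have /choice[p pc] n : exists p : (X -> \bar R) * (Y -> \bar R),
    dual_admissible k p.1 p.2 /\ dual_cost mu nu p.1 p.2 <= c + (4 ^- n)%:E.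
  have e0 : (0 < 4 ^- n :> R)%R by rewrite invr_gt0 exprn_gt0.
  have [_ [q qa <-] qc] := lb_ereal_inf_adherent e0 cfin.
  by exists q; split => //; exact: ltW.
pose a n := (p n).1; pose b n := (p n).2.
have ab n : dual_admissible k (a n) (b n) by have [] := pc n.
have ma n : measurable_fun setT (a n) by have [[]] := ab n.
have mb n : measurable_fun setT (b n) by have [[]] := ab n.
have a0 n x : 0 <= a n x by have [_ ->] := ab n.
have b0 n x : 0 <= b n x by have [_ _ ->] := ab n.
have gap n : \int[mu]_x root_gap (a n x) (a n.+1 x) ^+ 2 +
    \int[nu]_y root_gap (b n y) (b n.+1 y) ^+ 2 <= (2 / 4 ^+ n)%:E.
  have cc : c + c \is a fin_num by rewrite fin_numD cfin.
  rewrite -(leeD2lE _ _ cc).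
  apply: le_trans (dual_cost_gap k0 cmin (ab n) (ab n.+1)) _.
  apply: le_trans (leeD (pc n).2 (pc n.+1).2) _.
  rewrite addeACA leeD2l// -EFinD lee_fin.
  have p4 : (0 < 4 ^+ n :> R)%R by rewrite exprn_gt0.
  rewrite exprS invfM; have : (0 < (4 ^+ n)^-1 :> R)%R by rewrite invr_gt0.
  by lra.
have gap_ge0 d (T : measurableType d) (m : {finite_measure set T -> \bar R})
    (u : (T -> \bar R)^nat) n : 0 <= \int[m]_x root_gap (u n x) (u n.+1 x) ^+ 2.
  by apply: integral_ge0 => x _; rewrite expe_ge0// root_gap_ge0.
have C0 : (0 <= 2 :> R)%R by [].
have aC n : \int[mu]_x root_gap (a n x) (a n.+1 x) ^+ 2 <= (2 / 4 ^+ n)%:E.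
  by apply: le_trans (gap n); rewrite leeDl.
have bC n : \int[nu]_y root_gap (b n y) (b n.+1 y) ^+ 2 <= (2 / 4 ^+ n)%:E.
  by apply: le_trans (gap n); rewrite leeDr.
(* points of convergence x1, y1 make both limits positive, so that a product
   with a factor +oo is +oo *)
have [x1 rx1] := rapid_nonempty C0 ma a0 aC mu0.
have [y1 ry1] := rapid_nonempty C0 mb b0 bC nu0.
have limit_ge x y : rapid a x -> rapid b y ->
    (k x y)%:E <= rapid_limit a x * rapid_limit b y.
  move=> /(rapid_limitE a0)[l [l0 al ->]] /(rapid_limitE b0)[l' [l'0 bl' ->]].
  have abl : a n x * b n y @[n --> \oo] --> l%:E * l'%:E by apply: cvgeM.
  rewrite -(cvg_lim _ abl)//; apply: lime_ge; first exact: cvgP abl.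
  by apply: nearW => n; have [_ _ _] := ab n; apply.
have pos x y : rapid a x -> rapid b y ->
    0 < rapid_limit a x /\ 0 < rapid_limit b y.
  move=> rx ry; have : 0 < rapid_limit a x * rapid_limit b y.
    by apply: lt_le_trans (limit_ge _ _ rx ry); rewrite lte_fin.
  by have := rapid_limit_ge0 a0 x; have := rapid_limit_ge0 b0 y;
    rewrite !le_eqVlt => /predU1P[<-|->] /predU1P[<-|->];
    rewrite ?mule0 ?mul0e ?ltxx.
exists (rapid_limit a), (rapid_limit b); split.
- split; first split.
  + exact: measurable_rapid_limit C0 ma a0 aC.
  + exact: measurable_rapid_limit C0 mb b0 bC.
  + exact: rapid_limit_ge0.
  + exact: rapid_limit_ge0.
  + move=> x y; have [rx|rx] := boolP (rapid a x); have [ry|ry] := boolP (rapid b y).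
    * exact: limit_ge.
    * rewrite {2}/rapid_limit (negbTE ry) gt0_muley ?leey//.
      by have [] := pos _ _ rx ry1.
    * rewrite {1}/rapid_limit (negbTE rx) gt0_mulye ?leey//.
      by have [] := pos _ _ rx1 ry.
    * by rewrite /rapid_limit (negbTE rx) (negbTE ry) mulyy leey.
- move=> f g fg; apply: le_trans (cmin _ _ fg).
  apply: le_trans (leeD (integral_rapid_limit C0 ma a0 aC)
    (integral_rapid_limit C0 mb b0 bC)) _.
  pose A n := \int[mu]_x a n x; pose B n := \int[nu]_y b n y.
  have einfs_ge0 u : (forall n, 0 <= u n) -> 0 <= limn (@einfs R u).
    move=> u0; apply: lime_ge; first exact: is_cvg_einfs.
    by apply: nearW => n; apply: le_ereal_inf_tmp => _ [m _ <-].
  have A0 n : 0 <= A n by exact: integral_ge0.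
  have B0 n : 0 <= B n by exact: integral_ge0.
  have AB : limn (einfs A) +? limn (einfs B).
    by rewrite ge0_adde_def// inE einfs_ge0.
  rewrite !limn_einf_lim -limeD//; [|exact: is_cvg_einfs..].
  apply: lime_le; first by apply: is_cvgeD => //; exact: is_cvg_einfs.
  apply: nearW => n; apply/lee_addgt0Pr => e e0.
  have [m nm me] : exists2 m, (n <= m)%N & (4 ^- m <= e :> R)%R.
    have [m _ /(_ (maxn m n) (leq_maxl _ _)) me] :
      \forall m \near \oo, (m.+1%:R^-1 < e)%R.
      exact: near_infty_natSinv_lt (PosNum e0).
    exists (maxn m n); first exact: leq_maxr.
    apply: le_trans (ltW me); rewrite lef_pV2 ?posrE ?exprn_gt0//.
    by rewrite -natrX ler_nat ltn_expl.
  have inf_le u : einfs u n <= u m by apply: ereal_inf_lbound; exists m.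
  apply: le_trans (leeD (inf_le _ A) (inf_le _ B)) _.
  by apply: le_trans (pc m).2 _; rewrite leeD2l// lee_fin.
Qed.

(** * Conjugate minimisers and their perturbation *)

Section sup_transform.
Context (R : realType) (X : ptopologicalType) (k : X -> X -> R).
Hypotheses (k0 : forall x y, (0 < k x y)%R) (kC : forall x y, k x y = k y x).
Hypothesis kcont : forall y, continuous (k ^~ y).
Implicit Types (E : set X) (a b : X -> \bar R).

(** Because the real value of +oo is 0 and the inverse of 0 is 0, this is 1/b
    with the convention 1/+oo = 0. *)
Definition rcp b y : R := (fine (b y))^-1%R.

(** For k = exp(-c) and b = exp(-v) this is exp(-u), where u is the c-transform
    of v taken over E.  Restricting the supremum to E serves to locate the
    points y at which it is approached. *)
Definition sup_transform E b x := ereal_sup [set (k x y * rcp b y)%:E | y in E].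

Lemma sup_transform_ge E b x y : E y -> (k x y * rcp b y)%:E <= sup_transform E b x.
Proof. by move=> Ey; apply: ereal_sup_ubound; exists y. Qed.

Lemma sup_transform_gt E b x (c : \bar R) : c < sup_transform E b x ->
  exists2 y, E y & c < (k x y * rcp b y)%:E.
Proof. by move=> /ereal_sup_gt[_ [y Ey <-] cy]; exists y. Qed.

Lemma sup_transform_le E b x (c : \bar R) :
  (forall y, E y -> (k x y * rcp b y)%:E <= c) -> sup_transform E b x <= c.
Proof. by move=> h; apply: ge_ereal_sup => _ [y Ey <-]; exact: h. Qed.

Lemma sup_transformS E F b x : E `<=` F ->
  sup_transform E b x <= sup_transform F b x.
Proof. by move=> EF; apply: sup_transform_le => y /EF; exact: sup_transform_ge. Qed.

Lemma sup_transformU E F b x (c : \bar R) : sup_transform E b x < c ->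
  sup_transform F b x < c -> sup_transform (E `|` F) b x < c.
Proof.
move=> Ec Fc; apply: (@le_lt_trans _ _ (maxe (sup_transform E b x) (sup_transform F b x))).
  by apply: sup_transform_le => y [] /sup_transform_ge h; rewrite le_max h ?orbT.
by rewrite gt_max Ec.
Qed.

(** A supremum of continuous functions is lower semicontinuous, however large
    E is. *)
Lemma measurable_sup_transform E b :
  measurable_fun [set: borel X] (sup_transform E b : borel X -> \bar R).
Proof.
apply: (measurability _ (ErealGenOInfty.measurableE R)) => _ [_ [r ->] <-].
rewrite setTI; apply: open_borel.
rewrite (_ : _ @^-1` _ = \bigcup_(y in E) [set x | r < k x y * rcp b y]%R).
  apply: bigcup_open => y _.
  apply: (@open_comp _ _ (fun x => k x y * rcp b y)%R [set z | r < z]%R).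
    move=> x _; apply: cvgM; [exact: kcont|exact: cvg_cst].
  exact: open_gt.
apply/seteqP; split=> x /=; rewrite in_itv/= andbT.
  by move=> /sup_transform_gt[y Ey]; rewrite lte_fin; exists y.
move=> [y Ey] /=; rewrite -lte_fin => /lt_le_trans; apply.
exact: sup_transform_ge.
Qed.

Local Notation admissible := (@dual_admissible _ _ (borel X) (borel X) R k).

Lemma rcp_ge0 b y : 0 <= b y -> (0 <= rcp b y)%R.
Proof. by move=> b0; rewrite invr_ge0 fine_ge0. Qed.

Lemma rcp_gt0 b y : 0 < b y -> b y < +oo -> (0 < rcp b y)%R.
Proof. by move=> b0 by_; rewrite invr_gt0 fine_gt0// b0. Qed.

Lemma admissible_gt0 a b : admissible a b ->
  (forall x, 0 < a x) /\ (forall y, 0 < b y).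
Proof.
move=> [_ a0 b0 ab].
have p x y : 0 < a x * b y by apply: lt_le_trans (ab x y); rewrite lte_fin.
by split=> x; rewrite lt_neqAle ?a0 ?b0 andbT eq_sym; apply/eqP => e;
  have := p x x; rewrite e ?mule0 ?mul0e ltxx.
Qed.

Lemma admissibleC a b : admissible a b -> admissible b a.
Proof.
by move=> [[ma mb] a0 b0 ab]; split=> // x y; rewrite kC muleC.
Qed.

Lemma sup_transform_admissible_le a b x : admissible a b ->
  sup_transform setT b x <= a x.
Proof.
move=> adm; have [a0 b0] := admissible_gt0 adm; case: adm => _ _ _ ab.
apply: sup_transform_le => y _; have := ab x y; have := b0 y; rewrite /rcp.
case: (b y) => [r| |]//= r0 h; last by rewrite invr0 mulr0 ltW.
rewrite lte_fin in r0; move: h; case: (a x) (a0 x) => [s| |]//= s0.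
  by rewrite !lee_fin ler_pdivrMr.
by rewrite leey.
Qed.

Lemma le_mul_transform b x y c : (forall y, 0 < b y) -> 0 < c ->
  (k x y * rcp b y)%:E <= c -> (k x y)%:E <= c * b y.
Proof.
move=> b0 c0; have := b0 y; rewrite /rcp; case: (b y) => [r| |]//=.
  rewrite lte_fin => r0; case: c c0 => [s| |]//= s0.
    by rewrite !lee_fin ler_pdivrMr.
  by rewrite gt0_mulye ?lte_fin// ?leey.
by move=> _ _; rewrite gt0_muley ?leey.
Qed.

Lemma sup_transform_admissible b :
  measurable_fun [set: borel X] (b : borel X -> \bar R) ->
  (forall y, 0 < b y) -> (exists y, b y < +oo) ->
  admissible (sup_transform setT b) b.
Proof.
move=> mb b0 [y0 by0].
have t0 x : 0 < sup_transform setT b x.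
  apply: lt_le_trans (sup_transform_ge b x (I : setT y0)).
  by rewrite lte_fin mulr_gt0// rcp_gt0.
split => //.
- by split => //; exact: measurable_sup_transform.
- by move=> x; exact: ltW.
- by move=> y; exact: ltW.
- by move=> x y; apply: le_mul_transform => //; exact: sup_transform_ge.
Qed.

Definition conjugate_optimal (mu nu : {finite_measure set (borel X) -> \bar R}) a b :=
  [/\ admissible a b,
      dual_cost mu nu a b < +oo,
      forall f g : borel X -> \bar R, admissible f g ->
        dual_cost mu nu a b <= dual_cost mu nu f g,
      a = sup_transform setT b & b = sup_transform setT a].

Lemma conjugate_optimalC mu nu a b :
  conjugate_optimal mu nu a b -> conjugate_optimal nu mu b a.
Proof.
move=> [ab Joo Jmin ? ?]; split => //.
- exact: admissibleC.
- by rewrite /dual_cost addeC.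
- by move=> f g /admissibleC/Jmin; rewrite /dual_cost addeC [leRHS]addeC.
Qed.

Lemma integrable_lty_ex (mu : {finite_measure set (borel X) -> \bar R})
    (a : borel X -> \bar R) :
  measurable_fun setT a -> (forall x, 0 <= a x) -> 0 < mu setT ->
  \int[mu]_x a x < +oo -> exists x, a x < +oo.
Proof.
move=> ma a0 mu0 aoo; apply: contrapT => /forallNP h.
have := measure_infinite_integrand ma a0 aoo.
rewrite (_ : ~` _ = setT) => [m0|]; first by rewrite m0 ltxx in mu0.
by apply/seteqP; split => // x _ /=; exact: h.
Qed.

Lemma dual_cost_lty (mu nu : {finite_measure set (borel X) -> \bar R}) a b :
  admissible a b ->
  dual_cost mu nu a b < +oo ->
  \int[mu]_x a x < +oo /\ \int[nu]_x b x < +oo.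
Proof.
move=> [_ a0 b0 _] Joo; split; apply: le_lt_trans Joo; rewrite /dual_cost.
  by rewrite leeDl// integral_ge0.
by rewrite leeDr// integral_ge0.
Qed.

(** From a minimiser (a0,b0), setting b := sup k/a0 and then a := sup k/b can
    only decrease both functions, so (a,b) is still minimal; and b is the
    transform of a because a <= a0 on the one hand and k <= a b on the other. *)
Theorem exists_conjugate_optimal (mu nu : {finite_measure set (borel X) -> \bar R}) :
  (forall x y, (k x y <= 1)%R) -> 0 < mu setT -> 0 < nu setT ->
  exists a b, conjugate_optimal mu nu a b.
Proof.
move=> k1 mu0 nu0.
have adm1 : admissible (cst 1) (cst 1).
  by split => // x y; rewrite mule1 lee_fin.
have J1 : dual_cost mu nu (cst 1) (cst 1) < +oo.
  by rewrite /dual_cost !integral_cst// !mul1e lte_add_pinfty// -ge0_fin_numE// fin_num_measure.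
have [a0 [b0 [ab0 Jmin]]] :=
  @exists_dual_minimizer _ _ (borel X) (borel X) R mu nu k k0 mu0 nu0
  (ex_intro _ _ (ex_intro _ _ (conj adm1 J1))).
have Joo := le_lt_trans (Jmin _ _ adm1) J1.
have [a0oo b0oo] := dual_cost_lty ab0 Joo.
have [a00 b00] := admissible_gt0 ab0.
have [[ma0 mb0] _ _ _] := ab0.
have exa0 : exists x, a0 x < +oo.
  by apply: integrable_lty_ex mu0 a0oo => // x; exact: ltW.
have exb0 : exists x, b0 x < +oo.
  by apply: integrable_lty_ex nu0 b0oo => // x; exact: ltW.
pose b := sup_transform setT a0; pose a := sup_transform setT b.
have ab0' : admissible a0 b.
  exact/admissibleC/sup_transform_admissible.
have [_ bpos] := admissible_gt0 ab0'.
have bb0 y : b y <= b0 y by apply: sup_transform_admissible_le; exact: admissibleC.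
have aa0 x : a x <= a0 x by exact: sup_transform_admissible_le.
have [[_ mb] _ _ _] := ab0'.
have ab : admissible a b.
  apply: sup_transform_admissible => //.
  by have [y y1] := exb0; exists y; exact: le_lt_trans (bb0 y) y1.
have [apos _] := admissible_gt0 ab; have [[ma _] _ _ _] := ab.
have Jle : dual_cost mu nu a b <= dual_cost mu nu a0 b0.
  by apply: leeD; apply: ge0_le_integral => // x _; exact: ltW.
exists a, b; split => //.
- exact: le_lt_trans Jle Joo.
- by move=> f g /Jmin; exact: le_trans.
- apply/funext => y; apply/eqP; rewrite eq_le; apply/andP; split; last first.
    by apply: sup_transform_admissible_le; exact: admissibleC.
  apply: sup_transform_le => x _; apply: le_trans (sup_transform_ge a y (I : setT x)).
  rewrite lee_fin ler_pM2l//; have := aa0 x; have := apos x; rewrite /rcp.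
  case: (a x) => [r| |]//; case: (a0 x) => [s| |]//=; rewrite ?invr0.
  + by rewrite lte_fin lee_fin => r0 rs; rewrite lef_pV2// posrE (lt_le_trans r0).
  + by rewrite lte_fin => r0 _; rewrite invr_ge0 ltW.
Qed.

Lemma measurable_fun_mem d (T : measurableType d) (A : set T) :
  measurable A -> measurable_fun setT (fun x => x \in A).
Proof.
move=> mA; apply: (measurable_fun_bool true); rewrite setTI.
by rewrite (_ : _ @^-1` _ = A)//; apply/seteqP; split=> x /=; [exact: set_mem|exact: mem_set].
Qed.

Lemma integral_fine d (T : measurableType d) (m : {finite_measure set T -> \bar R})
    (f : T -> \bar R) (E : set T) : measurable_fun setT f ->
  (forall x, 0 <= f x) -> \int[m]_x f x < +oo -> measurable E ->
  \int[m]_(x in E) f x = \int[m]_(x in E) (fine (f x))%:E.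
Proof.
move=> mf f0 f_fin mE; have N0 := measure_infinite_integrand mf f0 f_fin.
apply: ae_eq_integral => //.
- exact: measurable_funTS.
- by apply/measurable_funTS/measurable_EFinP; exact: measurableT_comp.
exists (~` [set x | f x < +oo]); split => //.
  by apply: measurableC; rewrite -[X in measurable X]setTI;
    exact: emeasurable_fun_infty_o.
by move=> x /= fx fxoo; apply: fx => _; rewrite fineK// ge0_fin_numE.
Qed.

Section optimality.
Variables (mu nu : {finite_measure set (borel X) -> \bar R}).
Variables (a b : X -> \bar R) (opt : conjugate_optimal mu nu a b).

Let adm : admissible a b. Proof. by case: opt. Qed.

Lemma optimal_gt0 : (forall x, 0 < a x) /\ (forall x, 0 < b x).
Proof. exact: admissible_gt0 adm. Qed.

Let a0 x : 0 < a x. Proof. by have [h _] := optimal_gt0. Qed.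
Let b0 x : 0 < b x. Proof. by have [_ h] := optimal_gt0. Qed.
Let ma : measurable_fun setT (a : borel X -> \bar R).
Proof. by have [[]] := adm. Qed.
Let mb : measurable_fun setT (b : borel X -> \bar R).
Proof. by have [[]] := adm. Qed.

Lemma optimal_lty : \int[mu]_x a x < +oo /\ \int[nu]_x b x < +oo.
Proof. by case: opt => _ Joo _ _ _; exact: dual_cost_lty adm Joo. Qed.

(** The pair obtained by dividing a by 1 + t on W and multiplying b by 1 + t on
    U is admissible, so its cost is not below the minimum. *)
Lemma optimal_perturb (W U : set (borel X)) (t : R) : (0 < t)%R ->
  measurable W -> measurable U ->
  (forall x y, W x -> ~ U y -> (k x y)%:E <= (1 + t)^-1%:E * a x * b y) ->
  \int[mu]_(x in W) a x <= (1 + t)%:E * \int[nu]_(y in U) b y.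
Proof.
move=> t0 mW mU WU; have [aoo boo] := optimal_lty.
have t1 : (0 < 1 + t)%R by rewrite addr_gt0.
have t1V : (0 < (1 + t)^-1)%R by rewrite invr_gt0.
pose a' (x : borel X) := if x \in W then (1 + t)^-1%:E * a x else a x.
pose b' (y : borel X) := if y \in U then (1 + t)%:E * b y else b y.
have adm' : admissible a' b'.
  split.
  - split; apply: measurable_fun_ifT => //; try exact: measurable_funeM.
      exact: measurable_fun_mem.
    exact: measurable_fun_mem.
  - by move=> x; rewrite /a'; case: ifP => _; [apply: mule_ge0; rewrite ?lee_fin|]; exact: ltW.
  - by move=> x; rewrite /b'; case: ifP => _; [apply: mule_ge0; rewrite ?lee_fin|]; exact: ltW.
  - have [_ _ _ ab] := adm.
    move=> x y; rewrite /a' /b'; case: ifPn => xW; case: ifPn => yU.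
    + by rewrite muleACA -EFinM mulVf ?gt_eqF// mul1e.
    + by apply: WU; [rewrite -inE|move/mem_set; apply/negP].
    + rewrite muleCA; apply: le_trans (ab x y) _.
      by apply: lee_pemull; [apply: mule_ge0; exact: ltW|rewrite lee_fin lerDl ltW].
    + exact: ab.
have split_int (m : {finite_measure set (borel X) -> \bar R}) (f : borel X -> \bar R) V :
    measurable V -> measurable_fun setT f -> (forall x, 0 <= f x) ->
    \int[m]_x f x = \int[m]_(x in V) f x + \int[m]_(x in ~` V) f x.
  move=> mV mf f0; rewrite -ge0_integral_setU ?setUv//; first exact: measurableC.
  by rewrite disj_set2E setICr.
have [[ma' mb'] a'0 b'0 _] := adm'.
have := opt; move=> [_ _ /(_ _ _ adm') Jmin _ _].
move: Jmin aoo boo; rewrite /dual_cost.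
rewrite (split_int mu a W)// => [|x]; last exact: ltW.
rewrite (split_int mu a' W)//.
rewrite (split_int nu b U)// => [|x]; last exact: ltW.
rewrite (split_int nu b' U)//.
have -> : \int[mu]_(x in W) a' x = (1 + t)^-1%:E * \int[mu]_(x in W) a x.
  rewrite -ge0_integralZl ?lee_fin//.
  - by apply: eq_integral => x xW; rewrite /a' xW.
  - exact: measurable_funTS.
  - by move=> x _; exact: ltW.
  - exact: ltW.
have -> : \int[mu]_(x in ~` W) a' x = \int[mu]_(x in ~` W) a x.
  by apply: eq_integral => x; rewrite in_setC /a' => /negbTE ->.
have -> : \int[nu]_(x in U) b' x = (1 + t)%:E * \int[nu]_(x in U) b x.
  rewrite -ge0_integralZl ?lee_fin//.
  - by apply: eq_integral => x xW; rewrite /b' xW.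
  - exact: measurable_funTS.
  - by move=> x _; exact: ltW.
  - exact: ltW.
have -> : \int[nu]_(x in ~` U) b' x = \int[nu]_(x in ~` U) b x.
  by apply: eq_integral => x; rewrite in_setC /b' => /negbTE ->.
have ge0 (m : {finite_measure set (borel X) -> \bar R}) (f : borel X -> \bar R) V :
    (forall x, 0 < f x) -> 0 <= \int[m]_(x in V) f x.
  by move=> f0; apply: integral_ge0 => x _; exact: ltW.
move: (ge0 mu a W a0) (ge0 mu a (~` W) a0) (ge0 nu b U b0) (ge0 nu b (~` U) b0).
case: (\int[mu]_(x in W) a x) => [p| |]//;
case: (\int[mu]_(x in ~` W) a x) => [q| |]//;
case: (\int[nu]_(x in U) b x) => [r| |]//;
case: (\int[nu]_(x in ~` U) b x) => [s| |]//.
rewrite -!EFinM -!EFinD !lee_fin => p0 q0 r0 s0 Jmin _ _.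
have : (p - (1 + t)^-1 * p <= t * r)%R by lra.
have -> : (p - (1 + t)^-1 * p = t * ((1 + t)^-1 * p))%R.
  by field; rewrite gt_eqF.
by rewrite ler_pM2l// ler_pdivrMl.
Qed.

(** If the supremum a(x) is not approached off U, then for t small a(x) may be
    divided by 1 + t provided that b is multiplied by 1 + t on U; conclude by
    [optimal_perturb] and let t tend to 0. *)
Lemma optimal_push (U : set (borel X)) : measurable U ->
  \int[mu]_(x in [set x | a x < +oo /\ sup_transform (~` U) b x < a x]) a x
    <= \int[nu]_(y in U) b y.
Proof.
move=> mU; have [aoo boo] := optimal_lty.
(* W n is the set of points where the value t = 1/(n+1) is small enough *)
pose c n : R := ((1 + n.+1%:R^-1)^-1)%R.
pose W n : set (borel X) := [set x | sup_transform (~` U) b x <= (c n)%:E * a x].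
have mt := measurable_sup_transform (~` U) b.
have t0 n : (0 < n.+1%:R^-1 :> R)%R by rewrite invr_gt0.
have c0 n : (0 < c n)%R by rewrite invr_gt0 addr_gt0.
have mW n : measurable (W n).
  rewrite -[W n]setTI; apply: measurable_lee => //; exact: measurable_funeM.
have nW : nondecreasing_seq W.
  move=> m n mn; apply/subsetPset => x /= /le_trans; apply.
  rewrite lee_wpmul2r ?lee_fin//; first exact: ltW.
  by rewrite lef_pV2 ?posrE ?addr_gt0// lerD2l lef_pV2 ?posrE// ler_nat.
have Wle n : \int[mu]_(x in W n) a x <= (1 + n.+1%:R^-1)%R%:E * \int[nu]_(y in U) b y.
  apply: optimal_perturb => // x y Wx Uy; apply: le_mul_transform => //.
    by rewrite mule_gt0// lte_fin c0.
  by apply: le_trans Wx; exact: sup_transform_ge.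
set P : set (borel X) := [set x | _].
have mP : measurable P.
  rewrite (_ : P = [set x | a x < +oo] `&` [set x | sup_transform (~` U) b x < a x])//.
  apply: measurableI; rewrite -[X in measurable X]setTI.
    exact: emeasurable_fun_infty_o.
  exact: measurable_lte.
have PW : P `<=` \bigcup_n W n.
  move=> x [axoo ltx]; suff [n ?] : exists n, W n x by exists n.
  rewrite /W /=; move: axoo ltx (a0 x); case: (a x) => [s| |]// _.
  case: (sup_transform _ _ _) => [r| |]//; last by exists 0%N; rewrite leNye.
  rewrite !lte_fin => rs s0; have e0 : (0 < (s - r) / s)%R by rewrite divr_gt0// subr_gt0.
  have [n _ /(_ n (leqnn n)) ne] : \forall n \near \oo, (n.+1%:R^-1 < (s - r) / s)%R.
    exact: near_infty_natSinv_lt (PosNum e0).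
  exists n; rewrite -EFinM lee_fin ler_pdivlMl ?addr_gt0//.
  move: ne; rewrite ltr_pdivlMr// => ne.
  have := t0 n; set t := (n.+1%:R^-1)%R in ne *; nra.
apply: (@le_trans _ _ (\int[mu]_(x in \bigcup_n W n) a x)).
  apply: ge0_subset_integral => //; first exact: bigcup_measurable.
    exact: measurable_funTS.
  by move=> x _; exact: ltW.
have cW : \int[mu]_(x in W n) a x @[n --> \oo] --> \int[mu]_(x in \bigcup_n W n) a x.
  have mfa : measurable_fun setT (fine \o a : borel X -> R) by exact: measurableT_comp.
  have fa0 x : (0 <= (fine \o a) x)%R by rewrite fine_ge0// ltW.
  have intE (E : set (borel X)) : measurable E ->
      \int[mu]_(x in E) a x = weighted mu mfa fa0 E.
    by move=> mE; apply: integral_fine => // x; exact: ltW.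
  rewrite intE; last exact: bigcup_measurable.
  under eq_fun do rewrite intE//.
  by apply: nondecreasing_cvg_mu => //; exact: bigcup_measurable.
rewrite -(cvg_lim _ cW)//.
have cR : (1 + n.+1%:R^-1)%R%:E * \int[nu]_(y in U) b y @[n --> \oo] --> \int[nu]_(y in U) b y.
  rewrite -[X in _ --> X]mul1e; apply: cvgeZr.
    rewrite ge0_fin_numE; last by apply: integral_ge0 => y _; exact: ltW.
    apply: le_lt_trans boo; apply: ge0_subset_integral => //.
    by move=> y _; exact: ltW.
  apply: cvg_EFin; first exact: nearW.
  rewrite -[X in _ --> X]addr0; apply: cvgD; first exact: cvg_cst.
  exact: cvg_harmonic.
rewrite -[leRHS](cvg_lim _ cR)//; apply: lee_lim; [exact: cvgP cW|exact: cvgP cR|].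
exact: nearW.
Qed.

End optimality.

End sup_transform.

(** * Sets meeting every parallel to an axis at most once *)

(** By Fubini, since each section along the i-th coordinate has at most one
    point.  Lebesgue measure being an iterated product, the induction removes
    coordinates until the i-th one comes first. *)
Lemma lebesgue_rV_line_null (R : realType) d (i : 'I_d) (N : set (borel 'rV[R]_d)) :
  measurable N ->
  (forall x y : 'rV[R]_d, N x -> N y ->
    (forall j, j != i -> x ord0 j = y ord0 j) -> x = y) ->
  lebesgue_rV R d N = 0.
Proof.
elim: d i N => [[]//|n IH] i N mN lineN.
have mP : measurable (@row_cons R n @^-1` N).
  by rewrite -[X in measurable X]setTI; exact: measurable_row_cons.
rewrite /= /lebesgue_step /pushforward.
case: (unliftP ord0 i) lineN => [j|] -> lineN.
  rewrite /product_measure1; apply: integral0_eq => s _ /=.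
  apply: (IH j); first exact: measurable_xsection.
  move=> x y /xsectionP Nx /xsectionP Ny xy.
  have e : row_cons (s, x) = row_cons (s, y).
    apply: (lineN _ _ Nx Ny) => l; case: (unliftP ord0 l) => [l'|] -> lj.
      rewrite !row_consS; apply: xy; by apply: contra_neq lj => ->.
    by rewrite !row_cons0.
  by have := can_inj (@row_consK R n) e; case.
rewrite (@product_measure_unique _ _ _ _ _ _ _ (lebesgue_measure \x^ lebesgue_rV R n)%E)//.
  rewrite /product_measure2 /=; apply: integral0_eq => x _ /=.
  set A := ysection _ _.
  have [[s As]|A0] := pselect (exists s, A s); last first.
    rewrite (_ : A = set0); first exact: measure0.
    by apply/seteqP; split=> // s As; apply: A0; exists s.
  rewrite (_ : A = [set s]); first exact: lebesgue_measure_set1.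
  apply/seteqP; split=> [t At|_ ->//].
  have e : row_cons (t, x) = row_cons (s, x).
    move: At As => /ysectionP Nt /ysectionP Ns; apply: (lineN _ _ Nt Ns) => l.
    by case: (unliftP ord0 l) => [l'|] ->; rewrite ?eqxx// !row_consS.
  by have := can_inj (@row_consK R n) e; case.
by move=> A B mA mB; exact: product_measure2E.
Qed.

(** * The Gaussian kernel *)

Section gauss.
Local Open Scope ring_scope.
Context (R : realType) (d : nat).
Local Notation X := 'rV[R]_d.
Implicit Types x y : X.

Definition sqdist x y : R := (\sum_(i < d) (x ord0 i - y ord0 i) ^+ 2)%R.

Definition gauss x y : R := expR (- sqdist x y).

Lemma sqdistC x y : sqdist x y = sqdist y x.
Proof. by apply: eq_bigr => i _; rewrite -sqrrN opprB. Qed.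

Lemma sqdist_ge0 x y : (0 <= sqdist x y)%R.
Proof. by apply: sumr_ge0 => i _; exact: sqr_ge0. Qed.

Lemma gauss_gt0 x y : (0 < gauss x y)%R. Proof. exact: expR_gt0. Qed.

Lemma gauss_le1 x y : (gauss x y <= 1)%R.
Proof. by rewrite /gauss -expR0 ler_expR oppr_le0 sqdist_ge0. Qed.

Lemma gaussC x y : gauss x y = gauss y x.
Proof. by rewrite /gauss sqdistC. Qed.

Lemma gauss_continuous y : continuous (gauss^~ y).
Proof.
move=> x; have c i : (fun z : X => (z ord0 i - y ord0 i) ^+ 2) @ x -->
    (x ord0 i - y ord0 i) ^+ 2.
  have ci : (fun z : X => z ord0 i - y ord0 i) @ x --> x ord0 i - y ord0 i.
    have h : (fun z : X => z ord0 i) @ x --> x ord0 i by exact: coord_continuous.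
    exact: (cvgB h (cvg_cst _)).
  exact: (cvgM ci ci).
apply: (@continuous_comp _ _ _ (fun x => - sqdist x y) expR); last exact: continuous_expR.
have cs : (fun z : X => \sum_(i < d) (z ord0 i - y ord0 i) ^+ 2) @ x -->
    \sum_(i < d) (x ord0 i - y ord0 i) ^+ 2.
  exact: (cvg_big (@add_continuous R^o) _ (fun i _ => c i)).
exact: (cvgN cs).
Qed.

(** In the exponents only 2 (x - x').(y - y') survives, and x - x' has a single
    nonzero coordinate. *)
Lemma gauss_exchange i x x' y y' : (forall j, j != i -> x ord0 j = x' ord0 j) ->
  (gauss x y * gauss x' y' = gauss x y' * gauss x' y *
    expR (2 * (x ord0 i - x' ord0 i) * (y ord0 i - y' ord0 i)))%R.
Proof.
move=> xx'; rewrite /gauss -!expRD; congr expR.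
pose S (u v : X) := \sum_(j < d | j != i) (u ord0 j - v ord0 j) ^+ 2.
have D u v : sqdist u v = (u ord0 i - v ord0 i) ^+ 2 + S u v.
  by rewrite /sqdist (bigD1 i).
have SE v : S x' v = S x v by apply: eq_bigr => j ji; rewrite xx'.
by rewrite !D !SE; ring.
Qed.

(** Multiply the two lower bounds and apply the upper bounds to the exchanged
    products.  For x_i < x'_i this says that y_i cannot exceed y'_i by much:
    near-maximisers are monotone along the i-th axis. *)
Lemma gauss_cross i x x' y y' (q q' A A' t t' : R) :
  (forall j, j != i -> x ord0 j = x' ord0 j) ->
  (0 <= q)%R -> (0 <= q')%R -> (0 < t)%R -> (0 < t')%R ->
  (0 < A)%R -> (0 < A')%R ->
  (gauss x y' * q' <= A)%R -> (gauss x' y * q <= A')%R ->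
  (t * A < gauss x y * q)%R -> (t' * A' < gauss x' y' * q')%R ->
  (t * t' < expR (2 * (x ord0 i - x' ord0 i) * (y ord0 i - y' ord0 i)))%R.
Proof.
move=> xx' q0 q'0 t0 t'0 A0 A'0 h1 h2 h3 h4.
have tA := mulr_gt0 t0 A0; have tA' := mulr_gt0 t'0 A'0.
rewrite -(ltr_pM2r (mulr_gt0 A0 A'0)).
have -> : (t * t' * (A * A') = (t * A) * (t' * A'))%R by ring.
apply: (lt_le_trans (ltr_pM (ltW tA) (ltW tA') h3 h4)).
rewrite mulrACA (gauss_exchange _ _ xx').
set e := expR _.
have -> : (gauss x y' * gauss x' y * e * (q * q') =
  e * ((gauss x y' * q') * (gauss x' y * q)))%R by ring.
rewrite ler_pM2l ?expR_gt0// ler_pM// mulr_ge0//; exact/ltW/gauss_gt0.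
Qed.

End gauss.

(** * Concentration of near-maximisers *)

Section concentration.
Context (R : realType) (d : nat).
Local Notation X := 'rV[R]_d.
Implicit Types (x y : X) (i : 'I_d).
Variables a b : X -> \bar R.
Hypotheses (a0 : forall x, 0 < a x) (b0 : forall y, 0 < b y).
Local Notation Phi := (fun E => sup_transform (@gauss R d) E b).
Hypothesis aE : a = Phi setT.

Let PhiE E x : Phi E x <= a x.
Proof. by rewrite aE; exact: sup_transformS. Qed.

Let fine_a x : a x < +oo -> a x = (fine (a x))%:E.
Proof. by move=> h; rewrite fineK// ge0_fin_numE// ltW. Qed.

Let fine_a0 x : a x < +oo -> (0 < fine (a x))%R.
Proof. by move=> h; rewrite fine_gt0// a0. Qed.

Let gauss_le x y : a x < +oo -> (gauss x y * rcp b y <= fine (a x))%R.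
Proof.
by move=> h; rewrite -lee_fin -fine_a// aE; exact: sup_transform_ge.
Qed.

Lemma near_maximizer E x (t : R) : a x < +oo -> (t < 1)%R -> Phi E x = a x ->
  exists2 y, E y & (t * fine (a x) < gauss x y * rcp b y)%R.
Proof.
move=> axoo t1 PE; have : (t * fine (a x))%:E < Phi E x.
  by rewrite PE [ltRHS]fine_a// lte_fin gtr_pMl// fine_a0.
by move=> /sup_transform_gt[y Ey]; rewrite lte_fin; exists y.
Qed.

Definition above (i : 'I_d) (c : R) : set X := [set y | (c < y ord0 i)%R].
Definition below (i : 'I_d) (c : R) : set X := [set y | (y ord0 i < c)%R].

Let cross i x x' y y' (t t' : R) : (forall j, j != i -> x ord0 j = x' ord0 j) ->
  a x < +oo -> a x' < +oo -> (0 < t)%R -> (0 < t')%R ->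
  (t * fine (a x) < gauss x y * rcp b y)%R ->
  (t' * fine (a x') < gauss x' y' * rcp b y')%R ->
  (t * t' < expR (2 * (x ord0 i - x' ord0 i) * (y ord0 i - y' ord0 i)))%R.
Proof.
move=> xx' xoo x'oo t0 t'0 h h'.
apply: (gauss_cross (q := rcp b y) (q' := rcp b y')
  (A := fine (a x)) (A' := fine (a x'))) => //.
- by apply: rcp_ge0; exact: ltW.
- by apply: rcp_ge0; exact: ltW.
- exact: fine_a0.
- exact: fine_a0.
- exact: gauss_le.
- exact: gauss_le.
Qed.

Lemma no_crossing i x x' (c c' : R) : (forall j, j != i -> x ord0 j = x' ord0 j) ->
  a x < +oo -> a x' < +oo -> (c < c')%R -> (x ord0 i < x' ord0 i)%R ->
  Phi (above i c') x = a x -> Phi (below i c) x' = a x' -> False.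
Proof.
move=> xx' xoo x'oo cc' ltx up dn.
(* D is such that the factor in gauss_cross is below exp (- 2 D) = t * t *)
pose D := ((x' ord0 i - x ord0 i) * (c' - c))%R.
have D0 : (0 < D)%R by rewrite mulr_gt0// subr_gt0.
pose t := expR (- D).
have t1 : (t < 1)%R by rewrite /t -expR0 ltr_expR oppr_lt0.
have t0 : (0 < t)%R by exact: expR_gt0.
have [y yc' ty] := near_maximizer xoo t1 up.
have [y' y'c ty'] := near_maximizer x'oo t1 dn.
have := cross xx' xoo x'oo t0 t0 ty ty'.
rewrite /t -expRD ltr_expR /D; rewrite /above /below /= in yc' y'c.
by nra.
Qed.

Let no_far_pair i x x' y y' : (forall j, j != i -> x ord0 j = x' ord0 j) ->
  a x < +oo -> a x' < +oo -> (x ord0 i < x' ord0 i)%R ->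
  (2^-1 * fine (a x) < gauss x y * rcp b y)%R ->
  (2^-1 * fine (a x') < gauss x' y' * rcp b y')%R ->
  (y ord0 i - y' ord0 i < 2 / (x' ord0 i - x ord0 i))%R.
Proof.
move=> xx' xoo x'oo ltx h h'; rewrite ltNge; apply/negP => far.
(* otherwise the factor in gauss_cross is at most exp (- 4) <= 1/4 *)
have h0 : (0 < 2^-1 :> R)%R by rewrite invr_gt0.
have := cross xx' xoo x'oo h0 h0 h h'.
move: far; rewrite ler_pdivrMr ?subr_gt0// => far.
apply/negP; rewrite -leNgt.
have e4 : (expR (- 4) <= 2^-1 * 2^-1 :> R)%R.
  rewrite expRN -invfM lef_pV2 ?posrE ?expR_gt0 ?mulr_gt0//.
  by apply: le_trans (expR_ge1Dx _); lra.
apply: le_trans e4; rewrite ler_expR; nra.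
Qed.

Let nat_above (r : R) : exists n : nat, (r < n%:R)%R.
Proof.
exists (Num.bound `|r|); apply: le_lt_trans (ler_norm r) _.
exact: archi_boundP.
Qed.

Let half_lt1 : (2^-1 < 1 :> R)%R. Proof. by rewrite invf_lt1 ?ltr1n. Qed.

Lemma no_escape_up i x x' : (forall j, j != i -> x ord0 j = x' ord0 j) ->
  a x < +oo -> a x' < +oo -> (x ord0 i < x' ord0 i)%R ->
  (forall n : nat, Phi (above i n%:R) x = a x) -> False.
Proof.
move=> xx' xoo x'oo ltx up.
have [y' _ hy'] := near_maximizer x'oo half_lt1 (esym (congr1 (@^~ x') aE)).
have [n hn] := nat_above (y' ord0 i + 2 / (x' ord0 i - x ord0 i)).
have [y yn hy] := near_maximizer xoo half_lt1 (up n).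
have := no_far_pair xx' xoo x'oo ltx hy hy'; rewrite /above /= in yn.
by lra.
Qed.

Lemma no_escape_down i x x' : (forall j, j != i -> x ord0 j = x' ord0 j) ->
  a x < +oo -> a x' < +oo -> (x ord0 i < x' ord0 i)%R ->
  (forall n : nat, Phi (below i (- n%:R)) x' = a x') -> False.
Proof.
move=> xx' xoo x'oo ltx dn.
have [y _ hy] := near_maximizer xoo half_lt1 (esym (congr1 (@^~ x) aE)).
have [n hn] := nat_above (2 / (x' ord0 i - x ord0 i) - y ord0 i).
have [y' yn hy'] := near_maximizer x'oo half_lt1 (dn n).
have := no_far_pair xx' xoo x'oo ltx hy hy'; rewrite /below /= in yn.
by lra.
Qed.

(** In each coordinate, the near-maximisers of y |-> k(x,y)/b(y) neither lie on
    both sides of a gap nor escape to infinity.  Rational and integer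
    thresholds make this a countable family of conditions. *)
Definition concentrated x := a x < +oo /\ forall i,
  [/\ forall c c' : rat, (c < c')%R ->
        ~ (Phi (below i (ratr c)) x = a x /\ Phi (above i (ratr c')) x = a x),
      exists n : nat, Phi (above i n%:R) x < a x &
      exists n : nat, Phi (below i (- n%:R)) x < a x].

(** The supremum of the thresholds c such that a(x) is still approached by
    points whose i-th coordinate exceeds c. *)
Definition maximizer_sup i x : \bar R :=
  ereal_sup [set (ratr c)%:E | c in [set c : rat | Phi (above i (ratr c)) x = a x]].

Definition maximizer x : X := (\row_i fine (maximizer_sup i x))%R.

Let Phi_lt E x : Phi E x <> a x -> Phi E x < a x.
Proof. by move=> /eqP ne; rewrite lt_neqAle ne PhiE. Qed.

Let Phi_cover E F x : E `|` F = setT -> Phi E x < a x -> Phi F x = a x.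
Proof.
move=> EF Ea; apply: contrapT => /Phi_lt Fa.
by have := sup_transformU Ea Fa; rewrite EF -aE ltxx.
Qed.

Lemma maximizer_sup_fin i x : concentrated x -> maximizer_sup i x \is a fin_num.
Proof.
move=> [_ /(_ i)[_ [n hn] [m hm]]].
rewrite fin_numElt; apply/andP; split.
  apply: (@lt_le_trans _ _ (ratr (- m%:R - 1))%:E); first exact: ltNyr.
  (* the half-spaces y_i < -m and y_i > -m-1 overlap, hence cover everything *)
  apply: ereal_sup_ubound; exists (- m%:R - 1)%R => //=; apply: Phi_cover hm.
  apply/seteqP; split=> // y _; rewrite /below /above /=.
  rewrite rmorphB rmorphN rmorph_nat rmorph1.
  by have [h|h] := ltP (y ord0 i) (- m%:R)%R; [left|right; lra].
apply: (@le_lt_trans _ _ n%:R%:E); last exact: ltry.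
apply: ge_ereal_sup => _ [c /= hc <-]; rewrite lee_fin leNgt; apply/negP => nc.
move: hn; rewrite -hc ltNge => /negP; apply; apply: sup_transformS => y.
by rewrite /above /=; exact: lt_trans.
Qed.

Lemma lt_maximizer i x (p : R) : concentrated x -> (p < maximizer x ord0 i)%R ->
  Phi [set y | (y ord0 i <= p)%R] x < a x.
Proof.
move=> cx; rewrite mxE -lte_fin fineK ?maximizer_sup_fin//.
move=> /ereal_sup_gt[_ [c /= hc <-]]; rewrite lte_fin => pc.
have [q /[!in_itv]/= /andP[pq qc]] := rat_in_itvoo pc.
have [_ /(_ i)[h _ _]] := cx.
have qa : Phi (below i (ratr q)) x < a x.
  by apply: Phi_lt => hq; apply: (h q c) => //; rewrite -(ltr_rat R).
apply: le_lt_trans qa; apply: sup_transformS => y; rewrite /below /=.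
by move=> /le_lt_trans; apply.
Qed.

Lemma gt_maximizer i x (p : R) : concentrated x -> (maximizer x ord0 i < p)%R ->
  Phi [set y | (p <= y ord0 i)%R] x < a x.
Proof.
move=> cx; rewrite mxE => Tp.
have [q /[!in_itv]/= /andP[Tq qp]] := rat_in_itvoo Tp.
have qa : Phi (above i (ratr q)) x < a x.
  apply: Phi_lt => hq; move: Tq; rewrite -lte_fin fineK ?maximizer_sup_fin// ltNge.
  by move=> /negP; apply; apply: ereal_sup_ubound; exists q.
apply: le_lt_trans qa; apply: sup_transformS => y; rewrite /above /=.
exact: lt_le_trans.
Qed.

(** The complement of a box around the maximiser is a finite union of
    half-spaces, over each of which the supremum is smaller. *)
Lemma concentrated_at x (U : set X) : concentrated x -> open U -> U (maximizer x) ->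
  Phi (~` U) x < a x.
Proof.
move=> cx oU Ux.
have /nbhs_ballP[e /= e0 eU] : nbhs (maximizer x) U by exact: open_nbhs_nbhs.
pose F i := [set y : X | (y ord0 i <= maximizer x ord0 i - e)%R] `|`
            [set y : X | (maximizer x ord0 i + e <= y ord0 i)%R].
have Fa i : Phi (F i) x < a x.
  apply: sup_transformU; [apply: lt_maximizer => //|apply: gt_maximizer => //].
    by rewrite gtrBl.
  by rewrite ltrDl.
have Fs (s : seq 'I_d) : Phi [set y | exists2 i, i \in s & F i y] x < a x.
  elim: s => [|i s IHs].
    by apply: le_lt_trans (a0 x); apply: sup_transform_le => y [].
  apply: le_lt_trans (sup_transformU (Fa i) IHs); apply: sup_transformS => y.
  by move=> [j]; rewrite in_cons => /predU1P[->|js] Fj; [left|right; exists j].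
apply: le_lt_trans (Fs (enum 'I_d)); apply: sup_transformS => y /= Uy.
apply: contrapT => nF; apply: Uy; apply: eU; split=> // j i; rewrite (ord1 j).
apply: contrapT => far; apply: nF; exists i; first by rewrite mem_enum.
move/negP : far; rewrite -leNgt /F /= ler_normr => /orP[h|h]; [left|right]; lra.
Qed.

(** Let y0 be the maximiser.  If b(y0) exceeded k(x,y0)/a(x), then
    k(x',y0)/a(x') > k(x,y0)/a(x) for some x', and this would persist with a
    margin t < 1 for y near y0.  A near-maximiser y of x in that neighbourhood
    would then satisfy k(x',y)/b(y) > a(x'). *)
Lemma maximizer_contact x (bE : b = sup_transform (@gauss R d) setT a) :
  dual_admissible (X := borel X) (Y := borel X) (@gauss R d) a b ->
  concentrated x -> a x * b (maximizer x) = (gauss x (maximizer x))%:E.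
Proof.
move=> adm cx; have [xoo _] := cx; set y0 := maximizer x.
apply/eqP; rewrite eq_le; apply/andP; split; last by have [_ _ _] := adm; apply.
have A0 := fine_a0 xoo; set A := fine (a x) in A0.
suff : b y0 <= (gauss x y0 * A^-1)%:E.
  move=> h; apply: le_trans (lee_wpmul2l _ h) _; first exact: ltW.
  by rewrite (fine_a xoo) -EFinM lee_fin -/A mulrCA divff ?mulr1// gt_eqF.
rewrite bE; apply: sup_transform_le => x' _; rewrite lee_fin leNgt; apply/negP.
set r := rcp a x' => ltr.
have L0 : (0 < gauss x y0 * A^-1)%R by rewrite mulr_gt0 ?gauss_gt0// invr_gt0.
have R0 := lt_trans L0 ltr.
have r0 : (0 < r)%R by move: R0; rewrite pmulr_rgt0// gauss_gt0.
have x'oo : a x' < +oo.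
  by rewrite ltey; apply/eqP => e; move: r0; rewrite /r /rcp e /= invr0 ltxx.
have A'0 := fine_a0 x'oo; rewrite /r /rcp in ltr R0 r0; set A' := fine (a x') in A'0 ltr R0 r0.
pose L := (gauss x y0 * A^-1)%R; pose R' := (gauss y0 x' * A'^-1)%R.
(* any number strictly between L / R' and 1 would do *)
pose t := ((L / R' + 1) / 2)%R.
have LR : (L / R' < 1)%R by rewrite ltr_pdivrMr// mul1r.
have t1 : (t < 1)%R by rewrite /t; lra.
have t0 : (0 < t)%R.
  by rewrite /t divr_gt0// addr_gt0// divr_gt0.
have LtR : (L < t * R')%R.
  by rewrite -ltr_pdivrMr// /t; lra.
pose U := [set y | (0 < t * (gauss y x' * A'^-1) - gauss y x * A^-1)%R].
have oU : open U.
  apply: (@open_comp _ _ (fun y : X => t * (gauss y x' * A'^-1) - gauss y x * A^-1)%R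
    [set z | 0 < z]%R); last exact: open_gt.
  move=> y _; have cg (z : X) (s : R) :
      (fun y : X => gauss y z * s)%R @ y --> (gauss y z * s)%R.
    exact: (cvgM (@gauss_continuous R d z y) (cvg_cst s)).
  exact: (cvgB (cvgM (cvg_cst t) (cg _ _)) (cg _ _)).
have Uy0 : U y0 by rewrite /U /= subr_gt0 (gaussC y0 x).
have CU := concentrated_at cx oU Uy0.
have PU : Phi U x = a x by apply: Phi_cover CU; rewrite setUC setUv.
have [y Uy hy] := near_maximizer xoo t1 PU.
have := gauss_le y x'oo; rewrite -/A' => hy'.
move: Uy hy; rewrite /U /= subr_gt0 -/A (gaussC y x) (gaussC y x').
have g0 := gauss_gt0 x y; have g'0 := gauss_gt0 x' y.
set q := rcp b y in hy' *; rewrite ltr_pdivrMr// => h1 h2.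
have q0 : (0 < q)%R by have := mulr_gt0 t0 A0; nra.
have h3 : (gauss x y * q < t * (gauss x' y * A'^-1) * A * q)%R by rewrite ltr_pM2r.
have h4 : (t * (gauss x' y * A'^-1) * A * q <= t * A)%R.
  rewrite (_ : _ * q = t * A * (gauss x' y * q / A'))%R; last by ring.
  by apply: ler_piMr; [exact: mulr_ge0 (ltW t0) (ltW A0)|rewrite ler_pdivrMr// mul1r].
by have := lt_trans h2 (lt_le_trans h3 h4); rewrite ltxx.
Qed.

Let mPhi E : measurable_fun [set: borel X] (Phi E : borel X -> \bar R).
Proof. exact: measurable_sup_transform (@gauss_continuous R d) _ _. Qed.

Let ma : measurable_fun [set: borel X] (a : borel X -> \bar R).
Proof. by rewrite aE. Qed.

Let mPhi_eq E : measurable ([set x | Phi E x = a x] : set (borel X)).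
Proof.
by rewrite -[X in measurable X]setTI; exact: measurable_eqe.
Qed.

Section ae.
Variable mu : {finite_measure set (borel X) -> \bar R}.
Hypothesis mu_leb : mu `<< lebesgue_rV R d.

Let negligible_line i (N : set (borel X)) : measurable N ->
  (forall x x' : X, N x -> N x' -> (forall j, j != i -> x ord0 j = x' ord0 j) ->
    ~~ (x ord0 i < x' ord0 i)%R) ->
  mu.-negligible N.
Proof.
move=> mN h; apply/negligibleP => //.
apply: ((null_content_dominatesP _ _).1 mu_leb) => //.
apply: (lebesgue_rV_line_null (i := i)) => // x y Nx Ny xy.
apply/rowP => j; have [->|ji] := eqVneq j i; last exact: xy.
apply/eqP; rewrite eq_le !leNgt; apply/andP; split; apply: h => //.
by move=> k /xy.
Qed.

Let ae_count (I : countType) (P : I -> X -> Prop) :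
  (forall c, {ae mu, forall x, P c x}) -> {ae mu, forall x, forall c, P c x}.
Proof.
move=> h; pose Q n x := if unpickle n is Some c then P c x else True.
have : {ae mu, forall x, forall n, Q n x}.
  by apply: ae_foralln => n; rewrite /Q; case: unpickle => [c|]//; exact: aeW.
apply: (@filterS _ _ (ae_filter_ringOfSetsType mu)) => x Qx c.
by have := Qx (pickle c); rewrite /Q pickleK.
Qed.

(** Each of the countably many conditions fails on a set meeting every parallel
    to the i-th axis at most once, by [no_crossing], [no_escape_up] and
    [no_escape_down]. *)
Lemma ae_concentrated : \int[mu]_x a x < +oo ->
  {ae mu, forall x, concentrated x}.
Proof.
move=> aoo.
have mfin : measurable ([set x | a x < +oo] : set (borel X)).
  by rewrite -[X in measurable X]setTI; exact: emeasurable_fun_infty_o.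
have afin : {ae mu, forall x, a x < +oo}.
  exists (~` [set x | a x < +oo]); split => //; first exact: measurableC.
  by apply: measure_infinite_integrand => // x; exact: ltW.
have h1 i : {ae mu, forall x, forall c c' : rat, (c < c')%R -> a x < +oo ->
   ~ (Phi (below i (ratr c)) x = a x /\ Phi (above i (ratr c')) x = a x)}.
  apply: ae_count => c; apply: ae_count => c'.
  pose N : set (borel X) := [set x | a x < +oo] `&`
    ([set x | Phi (below i (ratr c)) x = a x] `&` [set x | Phi (above i (ratr c')) x = a x]).
  have [cc'|] := boolP (c < c')%R; last by move=> /negP ncc'; apply: aeW => x.
  have mN : measurable N by do 2![apply: measurableI => //].
  apply: (negligibleS _ (negligible_line (i := i) mN _)).
    by move=> x /= nh; apply: contrapT => nN; apply: nh => _ xoo [? ?]; apply: nN.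
  move=> x x' [xoo [_ up]] [x'oo [dn _]] xx'; apply/negP => ltx.
  by apply: (no_crossing xx' xoo x'oo _ ltx up dn); rewrite ltr_rat.
have escape i (F : nat -> set X) :
    (forall x x' : X, (forall j, j != i -> x ord0 j = x' ord0 j) ->
      a x < +oo -> a x' < +oo -> (forall n, Phi (F n) x = a x) ->
      (forall n, Phi (F n) x' = a x') -> ~~ (x ord0 i < x' ord0 i)%R) ->
    {ae mu, forall x, a x < +oo -> exists n : nat, Phi (F n) x < a x}.
  move=> hF; pose N : set (borel X) := [set x | a x < +oo] `&`
    \bigcap_n [set x | Phi (F n) x = a x].
  have mN : measurable N by apply: measurableI => //; exact: bigcapT_measurable.
  apply: (negligibleS _ (negligible_line (i := i) mN _)).
    move=> x /= nh; apply: contrapT => nN; apply: nh => xoo.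
    apply: contrapT => /forallNP nF; apply: nN; split=> // n _ /=.
    by apply: contrapT => /Phi_lt; exact: nF.
  move=> x x' [xoo hx] [x'oo hx'] xx'; apply: hF => // n; [exact: hx|exact: hx'].
have h2 i : {ae mu, forall x, a x < +oo -> exists n : nat, Phi (above i n%:R) x < a x}.
  apply: (escape i) => x x' xx' xoo x'oo up _; apply/negP => ltx.
  exact: no_escape_up xx' xoo x'oo ltx up.
have h3 i : {ae mu, forall x, a x < +oo -> exists n : nat, Phi (below i (- n%:R)) x < a x}.
  apply: (escape i) => x x' xx' xoo x'oo _ dn; apply/negP => ltx.
  exact: no_escape_down xx' xoo x'oo ltx dn.
have FF := ae_filter_ringOfSetsType mu.
have := @filterI _ _ FF _ _ (ae_count h1) (@filterI _ _ FF _ _ (ae_count h2) (ae_count h3)).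
move=> /(@filterI _ _ FF _ _ afin).
apply: (@filterS _ _ FF) => x [xoo [k1 [k2 k3]]]; split=> // i; split.
- by move=> c c' cc'; exact: k1.
- exact: k2.
- exact: k3.
Qed.

End ae.

Lemma measurable_maximizer_sup i :
  measurable_fun [set: borel X] (maximizer_sup i : borel X -> \bar R).
Proof.
apply: (measurability _ (ErealGenOInfty.measurableE R)) => _ [_ [r ->] <-].
rewrite setTI (_ : _ @^-1` _ = \bigcup_(c : rat)
  (if (r < ratr c)%R then [set x | Phi (above i (ratr c)) x = a x] else set0)).
  by apply: countable_bigcupT_measurable => // c; case: ifP.
apply/seteqP; split=> x /=; rewrite in_itv/= andbT.
  move=> /ereal_sup_gt[_ [c /= hc <-]]; rewrite lte_fin => rc.
  by exists c => //; rewrite rc.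
move=> [c _]; case: ifPn => // rc hc.
by apply: (@lt_le_trans _ _ (ratr c)%:E); [rewrite lte_fin|apply: ereal_sup_ubound; exists c].
Qed.

End concentration.

(** * Borel measurability into row vectors and products *)

(** Products become pointed topological spaces, to which the results on Borel
    sets of such spaces apply. *)
HB.instance Definition _ (T S : ptopologicalType) := Pointed.on (T * S)%type.

Section borel_row.
Context (R : realType) (n : nat).
Local Notation X := 'rV[R]_n.

Definition rat_ball (q : 'rV[rat]_n * nat) : set X :=
  ball (map_mx ratr q.1 : X) q.2.+1%:R^-1%R.

Lemma open_rat_ball (U : set X) : open U ->
  U = \bigcup_(q in [set q | rat_ball q `<=` U]) rat_ball q.
Proof.
move=> oU; apply/seteqP; split=> [x Ux|x [q /= qU qx]]; last exact: qU.
by have [q [qx qU]] := row_rat_ball oU Ux; exists q.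
Qed.

Context d (T : measurableType d).

Lemma measurable_fun_row (f : T -> X) :
  (forall i, measurable_fun setT (fun t => f t ord0 i)) ->
  measurable_fun setT (f : T -> borel X).
Proof.
move=> mf; refine (@measurability _ _ T (borel X) setT f (@open X) erefl _).
move=> _ [U oU <-]; rewrite setTI (open_rat_ball oU) preimage_bigcup bigcup_mkcond.
apply: countable_bigcupT_measurable => //= q; case: ifPn => // _.
rewrite (_ : _ @^-1` _ = \bigcap_(i : 'I_n)
    [set t | ball (ratr (q.1 ord0 i) : R) q.2.+1%:R^-1%R (f t ord0 i)]).
  apply: fin_bigcap_measurable => [|i _]; first exact: finite_finset.
  rewrite -[X in measurable X]setTI; apply: (mf i) => //.
  by apply: open_measurable; exact: ball_open.
apply/seteqP; split=> [t [_ qt] i _ /=|t qt].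
  by have := qt ord0 i; rewrite mxE.
split; first by rewrite invr_gt0.
by move=> j i; rewrite (ord1 j) mxE; exact: qt.
Qed.

(** A countable base of one factor is enough: an open W is the union, over the
    rational balls B, of the products of B with the interior of the set of y
    such that B x {y} is included in W. *)
Lemma measurable_fun_row_pair (Y : ptopologicalType) (f : T -> X) (g : T -> Y) :
  measurable_fun setT (f : T -> borel X) -> measurable_fun setT (g : T -> borel Y) ->
  measurable_fun setT ((fun t => (f t, g t)) : T -> borel (X * Y)%type).
Proof.
move=> mf mg.
refine (@measurability _ _ T (borel (X * Y)%type) setT _ (@open (X * Y)%type) erefl _).
move=> _ [W oW <-]; rewrite setTI.
pose V q : set Y := interior [set y | forall x, rat_ball q x -> W (x, y)].
rewrite (_ : _ @^-1` W = \bigcup_q (f @^-1` rat_ball q `&` g @^-1` V q)).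
  apply: countable_bigcupT_measurable => //= q; apply: measurableI;
    rewrite -[X in measurable X]setTI; [apply: mf|apply: mg] => //.
    by apply: open_borel; exact: ball_open.
  by apply: sub_sigma_algebra; exact: open_interior.
apply/seteqP; split=> [t Wt|t [q _ [qt]] /interior_subset]; last by apply.
have [[A B] /= [nA nB] AB] : nbhs (f t, g t) W by exact: open_nbhs_nbhs.
have [q [qt qA]] := row_rat_ball (@open_interior _ A) nA.
exists q => //; split=> //=; apply: filterS nB => y By x qx.
by apply: (AB (x, y)); split => //; apply: interior_subset; exact: qA.
Qed.

End borel_row.

(** * Borel structure of the cone *)

Section cone_measurability.
Context (R : realType) (d : nat).
Local Notation C := (cone R d).
Local Notation X := 'rV[R]_d.
Local Open Scope ring_scope.

Let class_mk (q : X * halfline R) : cone_class q = cone_mk q.1 q.2.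
Proof. by rewrite /cone_mk -surjective_pairing. Qed.

Let repr_class (q : X * halfline R) : 0 < hval q.2 -> repr (cone_class q) = q.
Proof.
move=> q0; have h : cone_mk (repr (cone_class q)).1 (repr (cone_class q)).2 = cone_mk q.1 q.2.
  by rewrite -!class_mk cone_reprK.
have [[e1 [/hval_inj e2 _]]|[_ e]] := (cone_mkP _ _ _ _).1 h; last first.
  by rewrite e ltxx in q0.
by rewrite [LHS]surjective_pairing e1 e2 -surjective_pairing.
Qed.

Let radius_class (q : X * halfline R) : cone_radius (cone_class q) = hval q.2.
Proof. by rewrite class_mk cone_radiusE. Qed.

Let hval2_continuous : continuous (fun q : X * halfline R => hval q.2).
Proof.
by move=> q; apply: continuous_comp; [exact: cvg_snd|exact: hval_continuous].
Qed.

(** At the vertex, neighbourhoods are balls for the radius; elsewhere a class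
    has a single representative. *)
Lemma cone_class_continuous : continuous (@cone_class R d).
Proof.
move=> q A; rewrite {1}/nbhs /= /cone_nbhs /= radius_class.
case: eqVneq => q0.
  move=> [e e0 eA]; have : nbhs (hval q.2) [set x : R | x < e].
    by apply: open_nbhs_nbhs; split; [exact: open_lt|rewrite /= q0].
  have sub : [set q' : X * halfline R | hval q'.2 < e] `<=` @cone_class R d @^-1` A.
    by move=> q' q'e; apply: eA; rewrite /= radius_class.
  by move=> /hval2_continuous; exact: (filterS sub).
have qp : 0 < hval q.2 by rewrite lt_neqAle eq_sym q0 hval_ge0.
rewrite repr_class// => -[N qN NA].
have sub : N `<=` @cone_class R d @^-1` A by move=> q' Nq'; apply: NA; exists q'.
exact: (filterS sub qN).
Qed.

Lemma cone_radius_continuous : continuous (@cone_radius R d).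
Proof.
move=> p A pA; rewrite /= /nbhs /= /cone_nbhs /=; case: eqVneq => p0.
  move: pA; rewrite p0 => /nbhs_ballP[e /= e0 eA]; exists e => // q /= qe.
  by apply: eA; rewrite /ball /= sub0r normrN ger0_norm// cone_radius_ge0.
exists ((fun q : X * halfline R => hval q.2) @^-1` A).
  exact: (hval2_continuous pA).
by move=> _ [q Aq <-] /=; rewrite radius_class.
Qed.

Lemma measurable_cone_radius :
  measurable_fun [set: borel C] (@cone_radius R d : borel C -> R).
Proof. exact: continuous_borelR cone_radius_continuous. Qed.

(** The base point is continuous off the vertex, and the vertex is a single
    point, so its arbitrary value there does not matter. *)
Lemma measurable_cone_point :
  measurable_fun [set: borel C] (@cone_point R d : borel C -> borel X).
Proof.
refine (@measurability _ _ (borel C) (borel X) setT _ (@open X) erefl _).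
move=> _ [U oU <-]; rewrite setTI.
pose v : C := cone_mk 0 (to_halfline (lexx 0)).
have vE (p : C) : cone_radius p = 0 -> p = v.
  move=> p0; rewrite -[p]cone_reprK class_mk; apply/cone_mkP; right.
  by split=> //; exact: p0.
have mv : measurable ([set p | cone_radius p = 0] : set (borel C)).
  rewrite -[X in measurable X]setTI.
  exact: (measurable_cone_radius measurableT (measurable_set1 0)).
pose V : set C := [set p | 0 < cone_radius p /\ U (cone_point p)].
have oV : open V.
  rewrite openE => p [p0 pU]; rewrite /interior /nbhs /= /cone_nbhs /= gt_eqF//.
  exists [set q : X * halfline R | 0 < hval q.2 /\ U q.1].
    apply: filterI.
      have : nbhs (hval (repr p).2) [set x : R | 0 < x].
        by apply: open_nbhs_nbhs; split=> //; exact: open_gt.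
      by move=> /hval2_continuous.
    have : nbhs (repr p).1 U by exact: open_nbhs_nbhs.
    by move=> /(@cvg_fst _ _ (nbhs (repr p).1) (nbhs (repr p).2)).
  move=> _ [q [q0 qU] <-]; rewrite /V /= class_mk.
  by rewrite cone_radiusE cone_pointE.
have mV := open_borel oV.
have [vU|vU] := pselect (U (cone_point v)).
  rewrite (_ : _ @^-1` U = V `|` [set p | cone_radius p = 0]).
    exact: measurableU.
  apply/seteqP; split=> p /=.
    have := cone_radius_ge0 p; rewrite le_eqVlt => /predU1P[p0|p0] pU; last by left.
    by right; exact: esym.
  by move=> [[]//|/vE ->].
rewrite (_ : _ @^-1` U = V)//; apply/seteqP; split=> p /=; last by case.
have := cone_radius_ge0 p; rewrite le_eqVlt => /predU1P[p0|p0] pU //.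
by exfalso; apply: vU; rewrite -(vE p).
Qed.

End cone_measurability.

(** * Weak duality *)

Section weak_duality.
Context (R : realType) (d : nat).
Local Notation C := (cone R d).
Local Notation X := 'rV[R]_d.

(** The constraint k <= a b bounds the Gaussian factor of the cost through its
    square. *)
Lemma gaussian_H_gauss (p q : C) : gaussian_H p q =
  (cone_radius p + cone_radius q - 2 * Num.sqrt (cone_radius p * cone_radius q)
     * Num.sqrt (gauss (cone_point p) (cone_point q)))%R.
Proof.
rewrite /gaussian_H; congr (_ - _ * _)%R.
rewrite /euclid_norm sqr_sqrtr; last by apply: sumr_ge0 => i _; exact: sqr_ge0.
rewrite /gauss /sqdist; under eq_bigr do rewrite !mxE.
set s := (\sum_i _)%R.
have -> : expR (- s) = (expR (- (s / 2)) ^+ 2)%R.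
  by rewrite expr2 -expRD; congr expR; field.
by rewrite sqrtr_sqr ger0_norm// expR_ge0.
Qed.

Lemma sqrt_amgm (u v : R) : (0 <= u -> 0 <= v -> 2 * Num.sqrt (u * v) <= u + v)%R.
Proof.
move=> u0 v0; rewrite sqrtrM//.
rewrite -[leRHS](congr2 +%R (sqr_sqrtr u0) (sqr_sqrtr v0)).
by have := sqr_ge0 (Num.sqrt u - Num.sqrt v); nra.
Qed.

Lemma gaussian_H_ge0 (p q : C) : (0 <= gaussian_H p q)%R.
Proof.
rewrite gaussian_H_gauss subr_ge0.
apply: le_trans (sqrt_amgm (cone_radius_ge0 p) (cone_radius_ge0 q)).
rewrite ler_piMr ?mulr_ge0 ?sqrtr_ge0//.
by rewrite -sqrtr1 ler_sqrt// gauss_le1.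
Qed.

(** The arithmetic-geometric mean inequality for a(x1) r1 and b(x2) r2, whose
    product is at least k(x1,x2) r1 r2. *)
Lemma gaussian_H_dual (a b : X -> \bar R) (p q : C) :
  (forall x, 0 <= a x) -> (forall y, 0 <= b y) ->
  (forall x y, (gauss x y)%:E <= a x * b y) ->
  (cone_radius p + cone_radius q)%:E <=
  (gaussian_H p q)%:E + (a (cone_point p) * (cone_radius p)%:E +
                         b (cone_point q) * (cone_radius q)%:E).
Proof.
move=> a0 b0 ab; have r0 := cone_radius_ge0 p; have s0 := cone_radius_ge0 q.
rewrite gaussian_H_gauss.
set r := cone_radius p in r0 *; set s := cone_radius q in s0 *.
set x := cone_point p; set y := cone_point q.
have [rs0|rs0] := eqVneq (r * s)%R 0%R.
  rewrite rs0 sqrtr0 mulr0 mul0r subr0 leeDl// adde_ge0// mule_ge0// lee_fin//.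
have rp : (0 < r)%R.
  by rewrite lt_neqAle r0 andbT eq_sym; apply: contra_neq rs0 => ->; rewrite mul0r.
have sp : (0 < s)%R.
  by rewrite lt_neqAle s0 andbT eq_sym; apply: contra_neq rs0 => ->; rewrite mulr0.
have := ab x y; have := a0 x; have := b0 y.
case: (a x) => [A| |]//; case: (b y) => [B| |]// B0 A0 AB.
- rewrite !lee_fin in B0 A0 AB *.
  have := sqrt_amgm (mulr_ge0 A0 r0) (mulr_ge0 B0 s0).
  have : (Num.sqrt (r * s) * Num.sqrt (gauss x y) <= Num.sqrt (A * r * (B * s)))%R.
    rewrite -sqrtrM ?mulr_ge0// ler_sqrt ?mulr_ge0//.
    by rewrite mulrACA mulrC ler_wpM2r// mulr_ge0.
  set u := Num.sqrt (r * s); set v := Num.sqrt (gauss _ _); set w := Num.sqrt (_ * _ * _).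
  by rewrite -mulrA; lra.
- by rewrite [+oo * _]gt0_mulye ?lte_fin// !addey// ?leey.
- by rewrite [+oo * _]gt0_mulye ?lte_fin// addye// addey// ?leey.
- by rewrite !gt0_mulye ?lte_fin// addye// addey// ?leey.
Qed.

Local Notation CC := (borel (C * C)%type).

Lemma measurable_borel_fst :
  measurable_fun [set: CC] ((fun p => p.1) : CC -> borel C).
Proof.
have h : continuous (fun p : (C * C)%type => p.1) by move=> p; exact: cvg_fst.
exact: (@continuous_borel (C * C)%type C _ h).
Qed.

Lemma measurable_borel_snd :
  measurable_fun [set: CC] ((fun p => p.2) : CC -> borel C).
Proof.
have h : continuous (fun p : (C * C)%type => p.2) by move=> p; exact: cvg_snd.
exact: (@continuous_borel (C * C)%type C _ h).
Qed.

Section gauss_measurable.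
Context d' (T : measurableType d').

Lemma measurable_coord (f : T -> borel X) i : measurable_fun setT f ->
  measurable_fun setT (fun t => (f t : X) ord0 i).
Proof.
have h : continuous (fun x : X => x ord0 i) by exact: coord_continuous.
exact: (measurableT_comp (@continuous_borelR X R _ h)).
Qed.

Lemma measurable_gauss (f g : T -> borel X) : measurable_fun setT f ->
  measurable_fun setT g -> measurable_fun setT (fun t => gauss (f t) (g t)).
Proof.
move=> mf mg.
have ms : measurable_fun setT (fun t => sqdist (f t) (g t)).
  have msi i : measurable_fun setT
      (fun t => ((f t : X) ord0 i - (g t : X) ord0 i) ^+ 2)%R.
    by apply: measurable_funX; apply: measurable_funB; exact: measurable_coord.
  exact: (measurable_sum _ msi).
exact: (measurableT_comp (@measurable_expR R) (measurableT_comp (@oppr_measurable R setT) ms)).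
Qed.

Lemma measurable_gaussian_H (f g : T -> borel C) : measurable_fun setT f ->
  measurable_fun setT g -> measurable_fun setT (fun t => gaussian_H (f t) (g t)).
Proof.
move=> mf mg.
have mr (h : T -> borel C) : measurable_fun setT h ->
    measurable_fun setT (fun t => cone_radius (h t)).
  by move=> mh; exact: (measurableT_comp (@measurable_cone_radius R d) mh).
have mp (h : T -> borel C) : measurable_fun setT h ->
    measurable_fun setT (fun t => cone_point (h t) : borel X).
  by move=> mh; exact: (measurableT_comp (@measurable_cone_point R d) mh).
have msqrt (h : T -> R) : measurable_fun setT h ->
    measurable_fun setT (fun t => Num.sqrt (h t)).
  exact: (measurableT_comp (continuous_measurable_fun (@sqrt_continuous R))).
under eq_fun do rewrite gaussian_H_gauss.
apply: measurable_funB; first by apply: measurable_funD; exact: mr.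
apply: measurable_funM; last by apply: msqrt; apply: measurable_gauss; exact: mp.
apply: measurable_funM => //; apply: msqrt.
by apply: measurable_funM; exact: mr.
Qed.

End gauss_measurable.

(** The marginal is the image, under the base point, of the plan weighted by
    the radius; points with r = 0 have weight 0. *)
Lemma integral_marginal (mu : {finite_measure set (borel X) -> \bar R})
    (alpha : {finite_measure set CC -> \bar R}) (pr : CC -> borel C)
    (f : borel X -> \bar R) :
  measurable_fun setT pr ->
  (forall A : set (borel X), measurable A -> mu A =
     \int[alpha]_(p in [set p | (0 < cone_radius (pr p))%R /\ A (cone_point (pr p))])
        (cone_radius (pr p))%:E) ->
  measurable_fun setT f -> (forall x, 0 <= f x) ->
  \int[mu]_x f x =
  \int[alpha]_p (f (cone_point (pr p)) * (cone_radius (pr p))%:E).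
Proof.
move=> mpr muE mf f0.
have mr : measurable_fun setT (fun p => cone_radius (pr p)).
  exact: (measurableT_comp (@measurable_cone_radius R d) mpr).
have mp : measurable_fun setT (fun p => cone_point (pr p) : borel X).
  exact: (measurableT_comp (@measurable_cone_point R d) mpr).
have r0 p : (0 <= cone_radius (pr p))%R by exact: cone_radius_ge0.
transitivity (\int[image_measure (weighted alpha mr r0) mp]_x f x).
  apply: eq_measure_integral => A mA _; rewrite [LHS](muE _ mA).
  change (\int[alpha]_(p in [set p | (0 < cone_radius (pr p))%R /\ A (cone_point (pr p))])
    (cone_radius (pr p))%:E = \int[alpha]_(p in (fun p => cone_point (pr p)) @^-1` A)
    (cone_radius (pr p))%:E).
  rewrite [LHS]integral_mkcond [RHS]integral_mkcond.
  apply: eq_integral => p _; rewrite !patchE.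
  have := r0 p; rewrite le_eqVlt => /predU1P[<-|rp]; first by rewrite !if_same.
  congr (if _ then _ else _); apply/idP/idP; rewrite !inE /=.
    by case.
  by [].
rewrite /image_measure ge0_integral_pushforward// preimage_setT.
rewrite integral_weighted//.
  exact: measurableT_comp.
by move=> p; exact: f0.
Qed.

Lemma weak_duality (mu1 mu2 : {finite_measure set (borel X) -> \bar R})
    (alpha : {finite_measure set CC -> \bar R}) (a b : borel X -> \bar R) :
  cone_plan mu1 mu2 alpha -> @dual_admissible _ _ (borel X) (borel X) R (@gauss R d) a b ->
  mu1 setT + mu2 setT <=
  \int[alpha]_p (gaussian_H p.1 p.2)%:E + (\int[mu1]_x a x + \int[mu2]_x b x).
Proof.
move=> [_ mu1E mu2E] [[ma mb] a0 b0 ab].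
have m1 := measurable_borel_fst; have m2 := measurable_borel_snd.
rewrite (integral_marginal m1 mu1E ma a0) (integral_marginal m2 mu2E mb b0).
have one (mu : {finite_measure set (borel X) -> \bar R}) : mu setT = \int[mu]_x 1.
  by rewrite integral_cst// mul1e.
rewrite (one mu1) (one mu2).
rewrite (integral_marginal m1 mu1E)//; rewrite (integral_marginal m2 mu2E)//.
have mr (pr : CC -> borel C) : measurable_fun setT pr ->
    measurable_fun setT (fun p => (cone_radius (pr p))%:E).
  move=> mpr; apply/measurable_EFinP.
  exact: (measurableT_comp (@measurable_cone_radius R d) mpr).
have mp (pr : CC -> borel C) (f : borel X -> \bar R) : measurable_fun setT pr ->
    measurable_fun setT f ->
    measurable_fun setT (fun p => f (cone_point (pr p)) * (cone_radius (pr p))%:E).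
  move=> mpr mf; apply: emeasurable_funM; last exact: mr.
  apply: (measurableT_comp mf).
  exact: (measurableT_comp (@measurable_cone_point R d) mpr).
have rge0 (f : borel X -> \bar R) (p : C) : (forall x, 0 <= f x) ->
    0 <= f (cone_point p) * (cone_radius p)%:E.
  by move=> f0; rewrite mule_ge0// lee_fin cone_radius_ge0.
have mH : measurable_fun setT (fun p : CC => (gaussian_H p.1 p.2)%:E).
  by apply/measurable_EFinP; exact: measurable_gaussian_H.
have H0 (p : CC) : 0 <= (gaussian_H p.1 p.2)%:E by rewrite lee_fin gaussian_H_ge0.
pose F (f : borel X -> \bar R) (pr : CC -> borel C) p :=
  f (cone_point (pr p)) * (cone_radius (pr p))%:E.
have intD (f g : borel X -> \bar R) : measurable_fun setT f -> measurable_fun setT g ->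
    (forall x, 0 <= f x) -> (forall x, 0 <= g x) ->
    \int[alpha]_p F f (fun p => p.1) p + \int[alpha]_p F g (fun p => p.2) p =
    \int[alpha]_p (F f (fun p => p.1) p + F g (fun p => p.2) p).
  move=> mf mg f0 g0; rewrite ge0_integralD//; try exact: mp.
    by move=> p _; exact: rge0.
  by move=> p _; exact: rge0.
have mF f pr := mp pr f.
rewrite [leLHS](intD (cst 1) (cst 1))// [in leRHS](intD a b)//.
rewrite -ge0_integralD//; last 2 first.
- by move=> p _; rewrite adde_ge0//; exact: rge0.
- by apply: emeasurable_funD; exact: mF.
apply: ge0_le_integral => //.
- by move=> p _; rewrite adde_ge0//; exact: rge0.
- by apply: emeasurable_funD; exact: mF.
- by apply: emeasurable_funD => //; apply: emeasurable_funD; exact: mF.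
- by move=> p _; rewrite /F !mul1e -EFinD; exact: gaussian_H_dual.
Qed.

End weak_duality.

(** * The transport-growth map *)

Lemma le_integral_ae_subset d (T : measurableType d) (R : realType)
    (m : {measure set T -> \bar R}) (A B : set T) (f : T -> \bar R) :
  measurable A -> measurable B -> measurable_fun setT f -> (forall x, 0 <= f x) ->
  {ae m, forall x, A x -> B x} -> \int[m]_(x in A) f x <= \int[m]_(x in B) f x.
Proof.
move=> mA mB mf f0 AB; rewrite [leLHS]integral_mkcond [leRHS]integral_mkcond.
apply: ae_ge0_le_integral => //.
- by move=> x _; apply: erestrict_ge0.
- exact/(measurable_restrictT _ mA).1/measurable_funTS.
- by move=> x _; apply: erestrict_ge0.
- exact/(measurable_restrictT _ mB).1/measurable_funTS.
apply: filterS AB => x AB _; rewrite !patchE; case: ifPn => [/set_mem/AB/mem_set ->//|_].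
by case: ifP.
Qed.

Section transport_map.
Context (R : realType) (d : nat).
Local Notation C := (cone R d).
Local Notation X := 'rV[R]_d.
Local Notation K := (@gauss R d).
Variables (mu1 mu2 : {finite_measure set (borel X) -> \bar R}).
Hypothesis mu1_leb : mu1 `<< lebesgue_rV R d.
Variables (a b : X -> \bar R).
Hypothesis opt : conjugate_optimal K mu1 mu2 a b.

Let kcont := @gauss_continuous R d.
Let k0 := @gauss_gt0 R d.
Let kC := @gaussC R d.

Let adm : @dual_admissible _ _ (borel X) (borel X) R K a b. Proof. by case: opt. Qed.
Let a0 x : 0 < a x. Proof. by have [h _] := optimal_gt0 k0 opt. Qed.
Let b0 x : 0 < b x. Proof. by have [_ h] := optimal_gt0 k0 opt. Qed.
Let ma : measurable_fun setT (a : borel X -> \bar R). Proof. by have [[]] := adm. Qed.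
Let mb : measurable_fun setT (b : borel X -> \bar R). Proof. by have [[]] := adm. Qed.
Let aE : a = sup_transform K setT b. Proof. by case: opt. Qed.
Let bE : b = sup_transform K setT a. Proof. by case: opt. Qed.
Let aoo : \int[mu1]_x a x < +oo. Proof. by have [] := optimal_lty opt. Qed.
Let boo : \int[mu2]_x b x < +oo. Proof. by have [] := optimal_lty opt. Qed.

Let T := maximizer a b : X -> X.

Let mT : measurable_fun setT (T : borel X -> borel X).
Proof.
apply: measurable_fun_row => i; under eq_fun do rewrite mxE.
apply: measurableT_comp => //; exact: measurable_maximizer_sup.
Qed.

Let ae_T : {ae mu1, forall x, concentrated a b x}.
Proof. exact: ae_concentrated. Qed.

(** The case U = setT of [optimal_push], for (a,b) and for (b,a). *)
Let mass : \int[mu1]_x a x = \int[mu2]_x b x.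
Proof.
have h (m1 m2 : {finite_measure set (borel X) -> \bar R}) f g :
    conjugate_optimal K m1 m2 f g -> \int[m1]_x f x <= \int[m2]_x g x.
  move=> o; have [f_fin _] := optimal_lty o.
  have [[mf _] f0 _ _] : @dual_admissible _ _ (borel X) (borel X) R K f g by case: o.
  have [fp _] := optimal_gt0 k0 o.
  apply: le_trans (optimal_push k0 kcont o measurableT).
  have mS : measurable [set x : borel X | f x < +oo].
    by rewrite -[X in measurable X]setTI; exact: emeasurable_fun_infty_o.
  rewrite (_ : [set x | _ /\ _] = [set x : borel X | f x < +oo]); last first.
    apply/seteqP; split=> [x []//|x fx]; split=> //; apply: le_lt_trans (fp x).
    by apply: sup_transform_le => y; rewrite setCT.
  apply: le_integral_ae_subset => //.
  exists (~` [set x | f x < +oo]); split; first exact: measurableC.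
    exact: measure_infinite_integrand.
  by move=> x /= h1 h2; exact: h1.
by apply/eqP; rewrite eq_le h//= h//; exact: conjugate_optimalC.
Qed.

Let mfa : measurable_fun setT (fine \o a : borel X -> R).
Proof. exact: measurableT_comp. Qed.
Let mfb : measurable_fun setT (fine \o b : borel X -> R).
Proof. exact: measurableT_comp. Qed.
Let fa0 x : (0 <= (fine \o a) x)%R. Proof. by rewrite fine_ge0// ltW. Qed.
Let fb0 x : (0 <= (fine \o b) x)%R. Proof. by rewrite fine_ge0// ltW. Qed.

Let P := image_measure (weighted mu1 mfa fa0) mT.
Let Q := weighted mu2 mfb fb0.

(** A concentrated x with T x in an open U satisfies the condition of
    [optimal_push], so P <= Q on open sets; the total masses are equal. *)
Let PQ (A : set (borel X)) : measurable A -> P A = Q A.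
Proof.
have PE (E : set (borel X)) : measurable E -> P E = \int[mu1]_(x in T @^-1` E) a x.
  move=> mE; rewrite [RHS]integral_fine// => [x|]; first exact: ltW.
  by rewrite -[X in measurable X]setTI; exact: mT.
have QE (E : set (borel X)) : measurable E -> Q E = \int[mu2]_(x in E) b x.
  by move=> mE; rewrite [RHS]integral_fine// => x; exact: ltW.
apply: eq_finite_measure_open => [U oU||].
- have mU : measurable (U : set (borel X)) by exact: open_borel.
  rewrite [leLHS]PE// [leRHS]QE//; apply: le_trans (optimal_push k0 kcont opt mU).
  apply: le_integral_ae_subset => //.
  + by rewrite -[X in measurable X]setTI; exact: mT.
  + rewrite (_ : [set x | _ /\ _] =
      [set x : borel X | a x < +oo] `&` [set x | sup_transform K (~` U) b x < a x])//.
    apply: measurableI; rewrite -[X in measurable X]setTI.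
      exact: emeasurable_fun_infty_o.
    apply: measurable_lte => //; exact: measurable_sup_transform.
  + by move=> x; exact: ltW.
  apply: (@filterS _ _ (ae_filter_ringOfSetsType mu1) _ _ _ ae_T) => x cx Ux; split; first by case: cx.
  exact: concentrated_at.
- by rewrite [leLHS]QE// [leRHS]PE// preimage_setT mass.
- by rewrite [ltLHS]PE// preimage_setT.
Qed.

(** Division by b o T turns the identity between the image of a mu1 and b mu2
    into one between the image of growth mu1 and mu2. *)
Definition growth x : R := (fine (a x) * rcp b (T x))%R.

Lemma growth_ge0 x : (0 <= growth x)%R.
Proof. by rewrite mulr_ge0 ?rcp_ge0 ?fine_ge0// ltW. Qed.

Let mrcp : measurable_fun setT (rcp b : borel X -> R).
Proof.
rewrite (_ : rcp b = (fun y => (fine (b y)) `^ (-1))%R); last first.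
  by apply/funext => y; rewrite powR_inv1// fine_ge0// ltW.
exact: (measurableT_comp (@measurable_powR R _) mfb).
Qed.

Lemma measurable_growth : measurable_fun setT (growth : borel X -> R).
Proof. by apply: measurable_funM => //; exact: (measurableT_comp mrcp mT). Qed.

Lemma growth_push (B : set (borel X)) : measurable B ->
  mu2 B = \int[mu1]_(x in T @^-1` B) (growth x)%:E.
Proof.
move=> mB; pose f (y : borel X) : \bar R := (\1_B y * rcp b y)%:E.
have mf : measurable_fun setT f.
  by apply/measurable_EFinP; apply: measurable_funM.
have f0 y : 0 <= f y by rewrite lee_fin mulr_ge0// rcp_ge0// ltW.
transitivity (\int[Q]_y f y).
  rewrite integral_weighted//.
  transitivity (\int[mu2]_y (\1_B y)%:E); first by rewrite integral_indic// setIT.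
  apply: ae_eq_integral => //.
  - by apply/measurable_EFinP.
  - by apply: emeasurable_funM => //; exact/measurable_EFinP.
  exists (~` [set y | b y < +oo]); split.
  - by apply: measurableC; rewrite -[X in measurable X]setTI; exact: emeasurable_fun_infty_o.
  - by apply: measure_infinite_integrand => // y; exact: ltW.
  move=> y /= h byoo; apply: h => _; rewrite /f -EFinM -mulrA mulVf ?mulr1//.
  by rewrite gt_eqF// fine_gt0// b0.
transitivity (\int[P]_y f y).
  by apply: eq_measure_integral => A mA _; exact/esym/PQ.
rewrite [LHS]ge0_integral_pushforward// preimage_setT integral_weighted//; last first.
- by move=> x; exact: f0.
- exact: measurableT_comp.
rewrite [RHS]integral_mkcond; apply: eq_integral => x _.
rewrite /f /= patchE /growth indicE -EFinM.
have -> : (x \in T @^-1` B) = (T x \in B) by apply/idP/idP; rewrite !inE.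
by case: (T x \in B); rewrite ?mul0r// mul1r mulrC.
Qed.

Lemma growth_integrable : mu1.-integrable setT (fun x : borel X => (growth x)%:E).
Proof.
apply/integrableP; split; first by apply/measurable_EFinP; exact: measurable_growth.
under eq_integral => x _ do rewrite gee0_abs ?lee_fin ?growth_ge0//.
rewrite -[X in \int[_]_(_ in X) _](preimage_setT T) -growth_push//.
by rewrite -ge0_fin_numE// fin_num_measure.
Qed.

(** Since a(x) b(T x) = k(x, T x), the product growth(x) k(x, T x) is a(x)^2, so
    the cross term of the cost is 2 a(x). *)
Lemma growth_contact x : concentrated a b x ->
  gaussian_H (cone_mk x (to_halfline ler01)) (cone_mk (T x) (to_halfline (growth_ge0 x))) =
  (1 + growth x - 2 * fine (a x))%R.
Proof.
move=> cx; have [xoo _] := cx.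
have A0 : (0 < fine (a x))%R by rewrite fine_gt0// a0.
have [gp gg] : (0 < growth x)%R /\ (growth x * gauss x (T x) = fine (a x) ^+ 2)%R.
  have := maximizer_contact a0 aE bE adm cx; rewrite -/T.
  rewrite -[in LHS](fineK (x := a x)) ?ge0_fin_numE//; last exact: ltW.
  have := b0 (T x); rewrite /growth /rcp; case: (b (T x)) => [B| |]//; last first.
    by move=> _; rewrite gt0_muley ?lte_fin.
  rewrite lte_fin -EFinM => B0 [<-] /=; split; first by rewrite divr_gt0.
  by field; rewrite gt_eqF.
rewrite gaussian_H_gauss !cone_radiusE !cone_pointE//= mul1r -mulrA -sqrtrM ?growth_ge0//.
by rewrite gg sqrtr_sqr ger0_norm// ltW.
Qed.

Definition growth_half x : halfline R := to_halfline (growth_ge0 x).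

Let borel_halfline_open (U : set (halfline R)) : open U ->
  exists2 V : set R, open V & U = @hval R @^-1` V.
Proof. by move=> [V oV <-]; exists V. Qed.

Lemma measurable_growth_half :
  measurable_fun setT (growth_half : borel X -> borel (halfline R)).
Proof.
refine (@measurability _ _ (borel X) (borel (halfline R)) setT _ (@open (halfline R)) erefl _).
move=> _ [U /borel_halfline_open[V oV ->] <-]; rewrite setTI.
rewrite (_ : _ @^-1` _ = growth @^-1` V)// -[X in measurable X]setTI.
by apply: measurable_growth => //; exact: open_measurable.
Qed.

Lemma transport_growth_maximizer : transport_growth_map mu1 T growth_half.
Proof.
split; last exact: growth_integrable.
exact: measurable_fun_row_pair measurable_growth_half.
Qed.

Let graph (x : borel X) : borel (C * C)%type :=
  (cone_mk x (to_halfline ler01), cone_mk (T x) (growth_half x)).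

Let mgraph : measurable_fun setT graph.
Proof.
have [mTg _] := transport_growth_maximizer.
have mc : measurable_fun setT (fun x : borel X => cone_class (T x, growth_half x) : borel C).
  have := continuous_borel (@cone_class_continuous R d).
  by move=> mcl; exact: (measurableT_comp mcl mTg).
have mid : measurable_fun setT ((fun x => x) : borel X -> borel X) by [].
have mxc := measurable_fun_row_pair mid mc.
have cont : continuous (fun p : X * C => (cone_mk p.1 (to_halfline ler01), p.2)).
  move=> p.
  have h1 : (fun q : X * C => (q.1, to_halfline ler01 : halfline R)) @ p -->
      (p.1, to_halfline ler01 : halfline R).
    have h2 : (fun q : X * C => q.1) @ p --> p.1 by exact: cvg_fst.
    exact: (cvg_pair h2 (cvg_cst _)).
  have h3 : (fun q : X * C => q.2) @ p --> p.2 by exact: cvg_snd.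
  exact: (cvg_pair (cvg_comp _ _ h1 (@cone_class_continuous R d _)) h3).
exact: (measurableT_comp (@continuous_borel (X * C)%type (C * C)%type _ cont) mxc).
Qed.

Let plan : {finite_measure set (borel (C * C)%type) -> \bar R} :=
  image_measure mu1 mgraph.

Let integral_plan (f : borel (C * C)%type -> \bar R) (D : set (borel (C * C)%type)) :
  measurable D -> measurable_fun setT f -> (forall p, 0 <= f p) ->
  \int[plan]_(p in D) f p = \int[mu1]_(x in graph @^-1` D) f (graph x).
Proof.
move=> mD mf f0; apply: (@ge0_integral_pushforward _ _ _ _ _ _ mgraph mu1 D f mD).
  exact: measurable_funTS.
by move=> p _; exact: f0.
Qed.

Lemma plan_cost : \int[plan]_p (gaussian_H p.1 p.2)%:E =
  \int[mu1]_x (gaussian_H (cone_mk x (to_halfline ler01)) (cone_mk (T x) (growth_half x)))%:E.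
Proof.
rewrite integral_plan//.
- by apply/measurable_EFinP; apply: measurable_gaussian_H;
    [exact: measurable_borel_fst|exact: measurable_borel_snd].
- by move=> p; rewrite lee_fin gaussian_H_ge0.
Qed.

Lemma plan_cone_plan : cone_plan mu1 mu2 plan.
Proof.
have m1 := @measurable_borel_fst R d; have m2 := @measurable_borel_snd R d.
have mr (pr : borel (C * C)%type -> borel C) : measurable_fun setT pr ->
    measurable_fun setT (fun p => cone_radius (pr p)).
  by move=> mpr; exact: (measurableT_comp (@measurable_cone_radius R d) mpr).
have mp (pr : borel (C * C)%type -> borel C) : measurable_fun setT pr ->
    measurable_fun setT (fun p => cone_point (pr p) : borel X).
  by move=> mpr; exact: (measurableT_comp (@measurable_cone_point R d) mpr).
have mD (pr : borel (C * C)%type -> borel C) (A : set (borel X)) :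
    measurable_fun setT pr -> measurable A ->
    measurable [set p | (0 < cone_radius (pr p))%R /\ A (cone_point (pr p))].
  move=> mpr mA; rewrite (_ : [set p | _] =
    (fun p => cone_radius (pr p)) @^-1` [set` `]0%R, +oo[] `&`
    (fun p => cone_point (pr p)) @^-1` A).
    apply: measurableI; rewrite -[X in measurable X]setTI.
      exact: mr.
    exact: mp.
  by apply/seteqP; split=> p /=; rewrite in_itv/= andbT.
split.
- rewrite integral_plan//; last 2 first.
  + by apply/measurable_EFinP; apply: measurable_funD; exact: mr.
  + by move=> p; rewrite lee_fin addr_ge0// cone_radius_ge0.
  rewrite preimage_setT /graph /=.
  under eq_integral do rewrite !cone_radiusE EFinD.
  rewrite ge0_integralD//=.
  + rewrite integral_cst// mul1e lte_add_pinfty//.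
      by rewrite -ge0_fin_numE// fin_num_measure.
    exact: integrable_lty growth_integrable.
  + by move=> x _; rewrite lee_fin growth_ge0.
  + by apply/measurable_EFinP; exact: measurable_growth.
- move=> A mA; rewrite integral_plan//; last 3 first.
  + exact: mD.
  + by apply/measurable_EFinP; exact: mr.
  + by move=> p; rewrite lee_fin cone_radius_ge0.
  rewrite (_ : _ @^-1` _ = A); last first.
    apply/seteqP; split=> x /=; rewrite cone_radiusE /= cone_pointE//=.
      by case.
  under eq_integral do rewrite /graph /= cone_radiusE /=.
  by rewrite integral_cst// mul1e.
- move=> A mA; rewrite integral_plan//; last 3 first.
  + exact: mD.
  + by apply/measurable_EFinP; exact: mr.
  + by move=> p; rewrite lee_fin cone_radius_ge0.
  rewrite [LHS]growth_push// [LHS]integral_mkcond [RHS]integral_mkcond.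
  apply: eq_integral => x _; rewrite !patchE /graph /= cone_radiusE /=.
  have := growth_ge0 x; rewrite le_eqVlt => /predU1P[<-|gp]; first by rewrite !if_same.
  congr (if _ then _ else _); apply/idP/idP; rewrite !inE /= cone_radiusE /= cone_pointE//.
  by case.
Qed.

(** The cost density is 1 + growth - 2 a almost everywhere, growth has integral
    mu2(R^d), and a and b have the same integral. *)
Lemma map_cost :
  \int[mu1]_x (gaussian_H (cone_mk x (to_halfline ler01)) (cone_mk (T x) (growth_half x)))%:E
  + (\int[mu1]_x a x + \int[mu2]_x b x) = mu1 setT + mu2 setT.
Proof.
set Hc := fun x : borel X =>
  (gaussian_H (cone_mk x (to_halfline ler01)) (cone_mk (T x) (growth_half x)))%:E.
have mHc : measurable_fun setT Hc.
  apply/measurable_EFinP.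
  apply: (@measurable_gaussian_H R d _ _ (fun x => (graph x).1) (fun x => (graph x).2)).
    exact: (measurableT_comp (@measurable_borel_fst R d) mgraph).
  exact: (measurableT_comp (@measurable_borel_snd R d) mgraph).
have Hc0 x : 0 <= Hc x by rewrite lee_fin gaussian_H_ge0.
have aeA : \int[mu1]_x a x = \int[mu1]_x (fine (a x))%:E.
  by apply: integral_fine => // x; exact: ltW.
have mfaE : measurable_fun setT (fun x : borel X => (fine (a x))%:E) by exact/measurable_EFinP.
have mgE : measurable_fun setT (fun x : borel X => (growth x)%:E).
  by apply/measurable_EFinP; exact: measurable_growth.
rewrite -mass aeA -ge0_integralD//; last 2 first.
- by move=> x _; rewrite lee_fin; exact: fa0.
- by move=> x _; rewrite lee_fin; exact: fa0.
rewrite -ge0_integralD//; last 2 first.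
- by move=> x _; rewrite adde_ge0// lee_fin; exact: fa0.
- exact: emeasurable_funD.
transitivity (\int[mu1]_x (1 + (growth x)%:E)).
  apply: ae_eq_integral => //.
  - by apply: emeasurable_funD => //; exact: emeasurable_funD.
  - exact: emeasurable_funD.
  apply: (@filterS _ _ (ae_filter_ringOfSetsType mu1) _ _ _ ae_T) => x cx _.
  rewrite /Hc growth_contact// -!EFinD; congr EFin; ring.
rewrite ge0_integralD//; last by move=> x _; rewrite lee_fin growth_ge0.
rewrite integral_cst// mul1e; congr (_ + _).
  by rewrite growth_push// preimage_setT.
by move=> x _; exact: Hc0.
Qed.

Lemma map_optimal :
  \int[mu1]_x (gaussian_H (cone_mk x (to_halfline ler01)) (cone_mk (T x) (growth_half x)))%:E
  = cone_cost (@gaussian_H R d) mu1 mu2.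
Proof.
apply/eqP; rewrite eq_le; apply/andP; split; last first.
  rewrite -plan_cost; apply: ereal_inf_lbound; exists plan => //; exact: plan_cone_plan.
apply: le_ereal_inf_tmp => _ [alpha alpha_plan <-].
have := weak_duality alpha_plan adm; rewrite -map_cost leeD2rE//.
have a_ge0 : 0 <= \int[mu1]_x a x by apply: integral_ge0 => x _; exact: ltW.
have b_ge0 : 0 <= \int[mu2]_x b x by apply: integral_ge0 => x _; exact: ltW.
by rewrite fin_numD !ge0_fin_numE// aoo boo.
Qed.

End transport_map.

Theorem theorem3 (R : realType) (d : nat)
    (mu1 mu2 : {finite_measure set (borel 'rV[R]_d) -> \bar R}) :
  0 < mu1 setT -> 0 < mu2 setT ->
  mu1 `<< lebesgue_rV R d ->
  exists (T : 'rV[R]_d -> 'rV[R]_d) (g : 'rV[R]_d -> halfline R),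
    [/\ transport_growth_map mu1 T g,
        forall B : set (borel 'rV[R]_d), measurable B ->
          mu2 B = pushforward (density_measure mu1 g)
                    (T : borel 'rV[R]_d -> borel 'rV[R]_d) B &
        \int[mu1]_x
          (gaussian_H (cone_mk x (to_halfline ler01)) (cone_mk (T x) (g x)))%:E
        = cone_cost (@gaussian_H R d) mu1 mu2].
Proof.
move=> mu1_gt0 mu2_gt0 mu1_leb.
have [a [b opt]] := exists_conjugate_optimal (@gauss_gt0 R d) (@gaussC R d)
  (@gauss_continuous R d) (@gauss_le1 R d) mu1_gt0 mu2_gt0.
exists (maximizer a b); exists (growth_half opt); split.
- exact: transport_growth_maximizer.
- by move=> B mB; exact: (growth_push mu1_leb opt mB).
- exact: map_optimal.
Qed.
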